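(* Let $X \in \mathbb{R}^{n \times d}$ and $\alpha > 0$. Let $q \in \mathbb{N}$ be even and $1 \le p \le q$. Let $\gamma_p = 1/p - 1/2$ when $p \le 2$ and $\gamma_p = 1/2 - 1/p$ when $p \ge 2$. There exists an algorithm running in time $O(n^2 d^2 + n d^3)$ that, given $X$, outputs a list $L$ containing $O(n+d)$ nonzero vectors in $\mathbb{R}^d$ such that \[ \|X\|_{p\to q} \le d^{\gamma_p + 1/4 - 1/(2q)} \cdot \max_{\hat v \in L} \frac{\|X\hat v\|_q}{\|\hat v\|_p} \le d^{\gamma_p + 1/4 - 1/(2q)} \cdot \|X\|_{p\to q}. \] Consequently, by computing $\|X\hat v\|_q$ for all $\hat v\in L$, in the same time one can: (1) certify that $\|X\|_{p\to q} \le \alpha\cdot d^{\gamma_p + 1/4 - 1/(2q)}$ whenever $\|X\|_{p\to q}\le\alpha$; that is, output a number $\mathrm{ALG}(X)$ with $\|X\|_{p\to q}\le \mathrm{ALG}(X)$ for every $X$ and $\mathrm{ALG}(X)\le \alpha\cdot d^{\gamma_p + 1/4 - 1/(2q)}$ whenever $\|X\|_{p\to q}\le\alpha$; (2) compute a vector $\hat v$ with $\|\hat v\|_p = 1$ and $\|X\hat v\|_q \ge \|X\|_{p\to q}/d^{\gamma_p + 1/4 - 1/(2q)}$.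
   Context: Here $\|\cdot\|_p$, $\|\cdot\|_q$ are the standard (unnormalized) $\ell_p$, $\ell_q$ norms, and for $X\in\mathbb R^{n\times d}$, $\|X\|_{p\to q} = \sup_{v\in\mathbb R^d,\ \|v\|_p = 1}\|Xv\|_q$. Running time is measured in arithmetic operations.
   Formalization: Running time is counted on a real machine where an exact eigendecomposition of a symmetric m×m matrix costs m^3 and a real power costs 1; with plain arithmetic operations alone the claim fails for p=q=2, where L must contain an exact top singular vector. Also n,d≥1 is assumed. *)

(* Defs.v *)
From HB Require Import structures.
From mathcomp Require Import all_boot all_order all_algebra.
From mathcomp Require Import all_classical all_reals all_analysis.
From mathcomp Require complex.

Set Implicit Arguments.
Unset Strict Implicit.
Unset Printing Implicit Defensive.

Import Order.TTheory GRing.Theory Num.Theory.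

Local Open Scope classical_set_scope.
Local Open Scope ring_scope.

Section Norms.
Variable R : realType.

Definition lpnorm (p : R) (k : nat) (v : 'cV[R]_k) : R :=
  (\sum_(i < k) `|v i 0| `^ p) `^ p^-1.

Definition opnorm (p q : R) (n d : nat) (X : 'M[R]_(n, d)) : R :=
  sup [set lpnorm q (X *m v) | v in [set v : 'cV[R]_d | lpnorm p v = 1]].

Definition gamma_exp (p : R) : R :=
  if p <= 2 then p^-1 - 2^-1 else 2^-1 - p^-1.

Definition approx_factor (p : R) (q d : nat) : R :=
  d%:R `^ (gamma_exp p + 4^-1 - (2 * q%:R)^-1).

(* The ratios are nonnegative, so for a nonempty list the default value 0 does
   not affect the maximum. *)
Definition max_ratio (p : R) (q : nat) (n d : nat) (X : 'M[R]_(n, d))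
    (L : seq 'cV[R]_d) : R :=
  \big[Num.max/0]_(v <- L) (lpnorm q%:R (X *m v) / lpnorm p v).

End Norms.

(* Model of computation: a real random access machine, programmed in a
   structured language.  A program is a finite syntactic object that does not
   depend on the size of its input.  The memory consists of integer registers
   and of two-dimensional real arrays of unbounded size; real numbers cannot be
   converted to integers.  Every node of an evaluated expression (constant,
   memory access, arithmetic operation), every executed command and every loop
   iteration costs one unit. *)
Section Machine.
Variable R : realType.

Inductive iexp : Type :=
| IConst of nat
| IVar of nat
| IAdd of iexp & iexp.

(* The exponent of [RPow] is a constant of the program; the operation is only
   meaningful on nonnegative arguments, [powR] being 1 on negative ones. *)
Inductive rexp : Type :=
| RConst of R
| RNat of iexp
| RGet of nat & iexp & iexp
| RAdd of rexp & rexp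
| RSub of rexp & rexp
| RMul of rexp & rexp
| RDiv of rexp & rexp
| RPow of rexp & R.

(* [CEig a e b c] reads the e x e matrix stored in array a, and writes an
   orthonormal eigenbasis (in columns) to array b and the corresponding
   eigenvalues to row 0 of array c. *)
Inductive cmd : Type :=
| CSkip
| CSeq of cmd & cmd
| CISet of nat & iexp
| CRSet of nat & iexp & iexp & rexp
| CIfLe of rexp & rexp & cmd & cmd
| CFor of nat & iexp & cmd
| CEig of nat & iexp & nat & nat.

Record state := State {
  ireg : nat -> nat;
  rmem : nat -> nat -> nat -> R }.

Definition set_ireg (x m : nat) (s : state) : state :=
  State (fun y => if y == x then m else ireg s y) (rmem s).

Definition set_array (a : nat) (A : nat -> nat -> R) (s : state) : state :=
  State (ireg s) (fun b => if b == a then A else rmem s b).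

Definition set_cell (a i j : nat) (r : R) (s : state) : state :=
  set_array a
    (fun k l => if (k == i) && (l == j) then r else rmem s a k l) s.

Definition put_mx (m k : nat) (M : 'M[R]_(m, k)) (A : nat -> nat -> R) :
    nat -> nat -> R :=
  fun i j => match insub i, insub j with
             | Some i', Some j' => M i' j'
             | _, _ => A i j
             end.

Fixpoint ieval (s : state) (e : iexp) : nat :=
  match e with
  | IConst m => m
  | IVar x => ireg s x
  | IAdd e1 e2 => (ieval s e1 + ieval s e2)%N
  end.

Fixpoint reval (s : state) (e : rexp) : R :=
  match e with
  | RConst r => r
  | RNat e1 => (ieval s e1)%:R
  | RGet a e1 e2 => rmem s a (ieval s e1) (ieval s e2)
  | RAdd e1 e2 => reval s e1 + reval s e2
  | RSub e1 e2 => reval s e1 - reval s e2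
  | RMul e1 e2 => reval s e1 * reval s e2
  | RDiv e1 e2 => reval s e1 / reval s e2
  | RPow e1 r => reval s e1 `^ r
  end.

Fixpoint icost (e : iexp) : nat :=
  match e with
  | IConst _ | IVar _ => 1
  | IAdd e1 e2 => (icost e1 + icost e2).+1
  end.

Fixpoint rcost (e : rexp) : nat :=
  match e with
  | RConst _ => 1
  | RNat e1 => (icost e1).+1
  | RGet _ e1 e2 => (icost e1 + icost e2).+1
  | RAdd e1 e2 | RSub e1 e2 | RMul e1 e2 | RDiv e1 e2 =>
      (rcost e1 + rcost e2).+1
  | RPow e1 _ => (rcost e1).+1
  end.

Definition eig_fun := forall m : nat, 'M[R]_m -> 'M[R]_m * 'rV[R]_m.

(* Nothing is assumed on the output for non-symmetric matrices, nor on the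
   choice of the basis or on the order of the eigenvalues. *)
Definition eigensolver (eig : eig_fun) : Prop :=
  forall (m : nat) (A : 'M[R]_m), A^T = A ->
    (eig m A).1^T *m (eig m A).1 = 1%:M /\
    A *m (eig m A).1 = (eig m A).1 *m diag_mx (eig m A).2.

Definition exec_eig (eig : eig_fun) (a m b c : nat) (s : state) : state :=
  let Ul := eig m (\matrix_(i < m, j < m) rmem s a i j) in
  let s' := set_array b (put_mx Ul.1 (rmem s b)) s in
  set_array c (put_mx Ul.2 (rmem s' c)) s'.

Fixpoint exec (eig : eig_fun) (c : cmd) (s : state) : state :=
  match c with
  | CSkip => s
  | CSeq c1 c2 => exec eig c2 (exec eig c1 s)
  | CISet x e => set_ireg x (ieval s e) s
  | CRSet a e1 e2 e => set_cell a (ieval s e1) (ieval s e2) (reval s e) s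
  | CIfLe e1 e2 c1 c2 =>
      if reval s e1 <= reval s e2 then exec eig c1 s else exec eig c2 s
  | CFor x e c1 =>
      iteri (ieval s e) (fun k s' => exec eig c1 (set_ireg x k s')) s
  | CEig a e b b' => exec_eig eig a (ieval s e) b b' s
  end.

(* The eigendecomposition of a symmetric m x m matrix is charged m ^ 3. *)
Fixpoint time (eig : eig_fun) (c : cmd) (s : state) : nat :=
  match c with
  | CSkip => 1
  | CSeq c1 c2 => (time eig c1 s + time eig c2 (exec eig c1 s)).+1
  | CISet _ e => (icost e).+1
  | CRSet _ e1 e2 e => (icost e1 + icost e2 + rcost e).+1
  | CIfLe e1 e2 c1 c2 =>
      (rcost e1 + rcost e2 +
       (if (reval s e1 <= reval s e2)%R then time eig c1 s
        else time eig c2 s)).+1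
  | CFor x e c1 =>
      (icost e + \sum_(k < ieval s e)
        (time eig c1 (set_ireg x k
           (iteri k (fun l s' => exec eig c1 (set_ireg x l s')) s))).+1).+1
  | CEig _ e _ _ => (icost e + ieval s e ^ 3).+1
  end%N.

(* Input: the dimensions in integer registers 0 and 1, the matrix in array 0;
   the rest of the memory is zero. *)
Definition init_state (n d : nat) (X : 'M[R]_(n, d)) : state :=
  State (fun x => nth 0%N [:: n; d] x)
        (fun a => if a == 0%N then put_mx X (fun _ _ => 0) else fun _ _ => 0).

(* Output conventions: a list of vectors has its length in integer register 2
   and its elements in the rows of array 1; a number is in cell (0, 0) of array
   2; a vector is in row 0 of array 3. *)
Definition out_list (d : nat) (s : state) : seq 'cV[R]_d :=
  [seq \col_(j < d) rmem s 1 k j | k <- iota 0 (ireg s 2)].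

Definition out_num (s : state) : R := rmem s 2 0 0.

Definition out_vec (d : nat) (s : state) : 'cV[R]_d :=
  \col_(j < d) rmem s 3 0 j.

End Machine.

(* The specification [eigensolver] is satisfiable: this is the spectral theorem
   for real symmetric matrices, proved by deflation along an eigenvector with a
   Householder reflection. *)
Section Spectral.
Import complex.
Local Open Scope sesquilinear_scope.
Variable R : rcfType.

Lemma sym_eigen (m : nat) (A : 'M[R]_m.+1) : A^T = A -> exists a, eigenvalue A a.
Proof.
move=> As; pose f := real_complex R.
have [//|mu] := @eigenvalue_closed _ m.+1 (map_mx f A).
have fA : (map_mx f A) ^t* = map_mx f A.
  apply/matrixP=> i j; rewrite !mxE -{1}As mxE conj_Creal//.
  by apply/complex_realP; exists (A i j).
move=> emu; have /eigenvalueP [v vA v0] := emu.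
have vv0 : (v *m v ^t*) 0 0 != 0.
  by rewrite -dotmxE dnorm_eq0.
have : mu * (v *m v ^t*) 0 0 \is Num.real.
  rewrite -[_ * _](_ : (v *m map_mx f A *m v ^t*) 0 0 = _); last first.
    by rewrite vA -scalemxAl mxE.
  rewrite CrealE; apply/eqP.
  set M := v *m _ *m _.
  have -> : (M 0 0)^* = (M ^t*) 0 0 by rewrite !mxE.
  congr (fun_of_matrix _ 0 0); rewrite /M !trmx_mul !map_mxM /= -mulmxA.
  by rewrite fA [X in X *m _]trmxCK.
rewrite mulrC realMr//; last by rewrite -dotmxE ger0_real// dnorm_ge0.
move=> /complex_realP [a mua]; exists a; move: emu.
by rewrite mua !eigenvalue_root_char -map_char_poly fmorph_root.
Qed.

Lemma rv_dot_gt0 (m : nat) (u : 'rV[R]_m) : u != 0 -> 0 < (u *m u^T) 0 0.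
Proof.
move=> u0; rewrite mxE lt_def; apply/andP; split; last first.
  by apply: sumr_ge0 => i _; rewrite mxE -expr2 sqr_ge0.
apply: contra u0 => /eqP h; apply/eqP/rowP => i; rewrite mxE.
have /psumr_eq0P : forall j : 'I_m, true -> 0 <= u 0 j * u^T j 0.
  by move=> j _; rewrite mxE -expr2 sqr_ge0.
by move=> /(_ h i isT)/eqP; rewrite mxE -expr2 sqrf_eq0 => /eqP.
Qed.

Lemma householder (m : nat) (e w : 'rV[R]_m) :
  e *m e^T = 1%:M -> w *m w^T = 1%:M ->
  exists H : 'M[R]_m, [/\ H^T = H, H *m H = 1%:M & e *m H = w].
Proof.
move=> ee ww; have [->|ne] := eqVneq w e.
  by exists 1%:M; rewrite trmx1 mulmx1 mulmx1.
pose u := w - e; have u0 : 0 < (u *m u^T) 0 0 by rewrite rv_dot_gt0// subr_eq0.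
set c := (u *m u^T) 0 0 in u0.
have uu : u *m u^T = c%:M by rewrite [LHS]mx11_scalar.
have we : w *m e^T = e *m w^T.
  rewrite [LHS]mx11_scalar [RHS]mx11_scalar; congr (_ %:M).
  by rewrite !mxE; apply: eq_bigr => i _; rewrite !mxE mulrC.
have E2 : 2%:M = 1%:M *+ 2 :> 'M[R]_1 by rewrite -scalemx1 scaler_nat.
have cE : c%:M = 2%:M - (e *m w^T) *+ 2 :> 'M[R]_1.
  rewrite -uu /u linearB /= mulmxBl !mulmxBr ee ww we.
  set x := e *m w^T.
  by rewrite E2 opprB -mulrnBl mulr2n.
have eu : (e *m u^T) *+ 2 = - c%:M.
  by rewrite cE /u linearB /= mulmxBr ee mulrnBl opprB E2.
exists (1%:M - (2 / c) *: (u^T *m u)); split.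
- by rewrite linearB /= linearZ /= trmx_mul trmxK trmx1.
- set P := u^T *m u.
  have PP : P *m P = c *: P.
    by rewrite /P mulmxA -(mulmxA u^T) uu mul_mx_scalar -scalemxAl.
  rewrite mulmxBl mul1mx mulmxBr mulmx1 -scalemxAl -scalemxAr PP !scalerA.
  have -> : 2 / c * (2 / c) * c = 2 / c + 2 / c.
    by rewrite -mulrA divfK ?gt_eqF// mulr_natr mulr2n.
  by rewrite scalerDl opprB addrK addrNK.
- rewrite mulmxBr mulmx1 -scalemxAr mulmxA.
  have -> : (2 / c) *: (e *m u^T *m u) = c^-1 *: ((e *m u^T *+ 2) *m u).
    by rewrite mulrC -scalerA scaler_nat !mulr2n mulmxDl.
  rewrite eu mulNmx mul_scalar_mx scalerN scalerA mulVf ?gt_eqF// scale1r opprK.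
  by rewrite /u addrC subrK.
Qed.

Lemma real_spectral (m : nat) (A : 'M[R]_m) : A^T = A ->
  exists U : 'M[R]_m * 'rV[R]_m,
    U.1^T *m U.1 = 1%:M /\ A *m U.1 = U.1 *m diag_mx U.2.
Proof.
elim: m A => [|m IH] A As.
  by exists (1%:M, 0); split; apply/matrixP=> -[].
have [a /eigenvalueP [w0 w0A w00]] := sym_eigen As.
pose w := (Num.sqrt ((w0 *m w0^T) 0 0))^-1 *: w0.
have ww : w *m w^T = 1%:M.
  rewrite /w; have c0 := rv_dot_gt0 w00; set c := (w0 *m _) 0 0 in c0 *.
  have w0E : w0 *m w0^T = c%:M by rewrite [LHS]mx11_scalar.
  rewrite linearZ /= -scalemxAl -scalemxAr scalerA w0E.
  rewrite scale_scalar_mx -invfM -expr2 sqr_sqrtr ?ltW//.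
  by rewrite mulVf// gt_eqF.
have wA : w *m A = a *: w by rewrite /w -scalemxAl w0A !scalerA mulrC.
pose e : 'rV[R]_(1 + m) := row_mx 1%:M 0.
have ee : e *m e^T = 1%:M.
  by rewrite /e tr_row_mx mul_row_col trmx1 mulmx1 mul0mx addr0.
have [H [HT HH eH]] := householder ee ww.
pose B : 'M[R]_(1 + m) := H *m A *m H.
have BT : B^T = B by rewrite /B !trmx_mul HT As mulmxA.
have wH : w *m H = e by rewrite -eH -mulmxA HH mulmx1.
have eB : e *m B = a *: e by rewrite /B !mulmxA eH wA -scalemxAl wH.
pose B' := drsubmx B.
have uB : usubmx B = a *: e.
  rewrite -eB -{2}[B]vsubmxK /e mul_row_col mul1mx mul0mx addr0.
  by [].
have BE : B = block_mx a%:M 0 0 B'.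
  rewrite -[B]submxK.
  have ul : ulsubmx B = a%:M.
    by rewrite /ulsubmx uB /e scale_row_mx row_mxKl scalemx1.
  have ur : ursubmx B = 0.
    by rewrite /ursubmx uB /e scale_row_mx row_mxKr scaler0.
  have dl : dlsubmx B = 0.
    by rewrite -BT -trmx_ursub ur trmx0.
  by rewrite ul ur dl.
have B'T : B'^T = B' by rewrite /B' trmx_drsub BT.
have [[U l] /= [UU BU]] := IH B' B'T.
pose V : 'M[R]_(1 + m) := block_mx 1%:M 0 0 U.
have VV : V^T *m V = 1%:M.
  rewrite /V tr_block_mx mulmx_block !trmx0 !mul0mx !mulmx0 trmx1 mulmx1.
  by rewrite !addr0 add0r UU -scalar_mx_block.
have BV : B *m V = V *m diag_mx (row_mx a%:M l).
  rewrite BE /V diag_mx_row !mulmx_block !mul0mx !mulmx0 !addr0 !add0r BU.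
  rewrite mulmx1 mul1mx; congr block_mx.
  by apply/matrixP=> i j; rewrite !ord1 !mxE.
exists (H *m V, row_mx a%:M l) => /=; split.
  by rewrite trmx_mul HT mulmxA -(mulmxA V^T) HH mulmx1.
have -> : A *m (H *m V) = H *m (B *m V) by rewrite /B !mulmxA HH mul1mx.
by rewrite BV mulmxA.
Qed.

End Spectral.

Lemma eigensolver_exists (R : realType) : exists eig : eig_fun R, eigensolver eig.
Proof.
pose eig : eig_fun R := fun m A =>
  if pselect (A^T = A) is left As then projT1 (cid (real_spectral As))
  else (1%:M, 0).
exists eig => m A As; rewrite /eig; case: pselect => // As'.
by case: cid.
Qed.

(* Main.v *)
Require Import Defs.
From mathcomp Require Import all_boot all_order all_algebra.
From mathcomp Require Import all_classical all_reals all_analysis.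
From mathcomp Require Import ring lra zify.

(* Write q = 2m + 2, let x_i be the rows of X and F(v) = \sum_i <x_i, v> ^ q.
   The candidates are, for every k, the row u = x_k and the top eigenvector w of
   G_u = \sum_i <x_i, u> ^ (2m) x_i x_i^T.  Given v, put c_k = <x_k, v> ^ 2.
   Cauchy-Schwarz for the tensor \sum_k c_k x_k^{(x) 2m} against v^{(x) 2m} and
   against I^{(x) m} bounds F(v) (\sum_k c_k |x_k| ^ (2m)) by
   |v| ^ (2m) d ^ (m/2) \sum_k c_k <v, G_{x_k} v>, so some row u satisfies
   F(v) |u| ^ (2m) <= |v| ^ (2m) d ^ (m/2) <v, G_u v>.  There
   <v, G_u v> <= |v| ^ 2 <w, G_u w>, and weighted AM-GM, applied termwise to
   <w, G_u w>, shows that u or w is a (d ^ (m/2))-approximate maximizer of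
   F(z) / |z| ^ q.  Comparing the l_p and l_2 norms costs the factor
   d ^ gamma_p. *)

Set Implicit Arguments.
Unset Strict Implicit.
Unset Printing Implicit Defensive.

Import Order.TTheory GRing.Theory Num.Theory.

Local Open Scope ring_scope.

Lemma exprn_sum_mul (R : comNzRingType) (J : finType) (a b : J -> R) (m : nat) :
  (\sum_j a j * b j) ^+ m =
  \sum_(f : {ffun 'I_m -> J}) (\prod_t a (f t)) * \prod_t b (f t).
Proof.
rewrite -[LHS](_ : \prod_(t < m) (\sum_j a j * b j) = _); last first.
  by rewrite prodr_const card_ord.
by rewrite bigA_distr_bigA; apply: eq_bigr => f _; rewrite big_split.
Qed.

Section SumInequalities.
Variable R : realFieldType.

Lemma cauchy_schwarz_sum (I : finType) (a b : I -> R) :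
  (\sum_i a i * b i) ^+ 2 <= (\sum_i a i ^+ 2) * (\sum_i b i ^+ 2).
Proof.
have : 0 <= \sum_i \sum_j (a i * b j - a j * b i) ^+ 2.
  by apply: sumr_ge0 => i _; apply: sumr_ge0 => j _; exact: sqr_ge0.
have -> : \sum_i \sum_j (a i * b j - a j * b i) ^+ 2 =
    \sum_i \sum_j (a i ^+ 2 * b j ^+ 2) + \sum_i \sum_j (a j ^+ 2 * b i ^+ 2)
    - 2 * \sum_i \sum_j ((a i * b i) * (a j * b j)).
  rewrite mulr_sumr -big_split -sumrB; apply: eq_bigr => i _ /=.
  rewrite mulr_sumr -big_split -sumrB; apply: eq_bigr => j _ /=; ring.
rewrite [X in _ + X - _]exchange_big /= -!big_distrlr /= -expr2.
lra.
Qed.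

(* Cauchy-Schwarz between the tensors [\sum_k c k *: A k ^{(x) m}] and
   [b ^{(x) m}]. *)
Lemma cauchy_schwarz_tensor (I J : finType) (c : I -> R) (A : I -> J -> R)
    (b : J -> R) (m : nat) :
  (\sum_k c k * (\sum_j A k j * b j) ^+ m) ^+ 2 <=
  (\sum_k \sum_l c k * c l * (\sum_j A k j * A l j) ^+ m) *
  (\sum_j b j ^+ 2) ^+ m.
Proof.
pose T (f : {ffun 'I_m -> J}) := \sum_k c k * \prod_t A k (f t).
pose B (f : {ffun 'I_m -> J}) := \prod_t b (f t).
have -> : \sum_k c k * (\sum_j A k j * b j) ^+ m = \sum_f T f * B f.
  under [RHS]eq_bigr do rewrite mulr_suml.
  rewrite [RHS]exchange_big /=; apply: eq_bigr => k _ /=.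
  by rewrite exprn_sum_mul mulr_sumr; apply: eq_bigr => f _; rewrite mulrA.
have -> : \sum_k \sum_l c k * c l * (\sum_j A k j * A l j) ^+ m =
    \sum_f T f ^+ 2.
  under [RHS]eq_bigr do rewrite expr2 big_distrlr /=.
  rewrite [RHS]exchange_big /=; apply: eq_bigr => k _ /=.
  rewrite [RHS]exchange_big /=; apply: eq_bigr => l _ /=.
  rewrite exprn_sum_mul mulr_sumr; apply: eq_bigr => f _; ring.
have -> : (\sum_j b j ^+ 2) ^+ m = \sum_f B f ^+ 2.
  under eq_bigr do rewrite expr2.
  by rewrite exprn_sum_mul; apply: eq_bigr => f _; rewrite expr2.
exact: cauchy_schwarz_sum.
Qed.

Lemma weighted_amgm (m : nat) (a b : R) : 0 <= a -> 0 <= b ->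
  m.+1%:R * (a ^+ m * b) <= m%:R * a ^+ m.+1 + b ^+ m.+1.
Proof.
move=> a_ge0 b_ge0.
elim: m => [|m IH]; first by rewrite expr0 expr1 !mul1r mul0r add0r.
have gap_ge0 : 0 <= a ^+ m * (m.+1%:R * (a - b) ^+ 2).
  by rewrite mulr_ge0 ?exprn_ge0// mulr_ge0 ?ler0n ?sqr_ge0.
rewrite -subr_ge0; rewrite -subr_ge0 in IH.
have := addr_ge0 gap_ge0 (mulr_ge0 IH b_ge0); congr (_ <= _).
rewrite -!natr1 !exprS; ring.
Qed.

Lemma cross_le_trans (c t w x y z : R) : 0 < y -> 0 <= c -> 0 <= w ->
  x * y <= c * z -> z * w <= y * t -> x * w <= c * t.
Proof.
move=> y_gt0 c_ge0 w_ge0 xy_le zw_le; rewrite -(ler_pM2r y_gt0) mulrAC.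
apply: le_trans (ler_wpM2r w_ge0 xy_le) _.
by rewrite -!mulrA [t * y]mulrC ler_wpM2l.
Qed.

Lemma exists_le_of_weighted_sum_le (I : finType) (c a b : I -> R) :
  (forall i, 0 <= c i) -> (exists i, 0 < c i) ->
  \sum_i c i * a i <= \sum_i c i * b i -> exists2 i, 0 < c i & a i <= b i.
Proof.
move=> c_ge0 [j cj].
have [i /andP[ci ab] _|none] := pickP [pred i | (0 < c i) && (a i <= b i)].
  by exists i.
have b_lt_a i : 0 < c i -> b i < a i.
  by move=> ci; move: (none i); rewrite /= ci /= ltNge => ->.
rewrite leNgt => /negP[]; rewrite (bigD1 j)//= [ltRHS](bigD1 j)//=.
apply: ltr_leD => [|]; first by rewrite ltr_pM2l ?b_lt_a.
apply: ler_sum => i _; have [ci|ci] := eqVneq (c i) 0; first by rewrite ci !mul0r.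
by rewrite ler_wpM2l// ltW// b_lt_a// lt_def ci c_ge0.
Qed.

End SumInequalities.

Section DotProduct.
Variables (R : comNzRingType) (d : nat).
Implicit Types (u v : 'cV[R]_d) (A : 'M[R]_d).

Definition dotv u v : R := \sum_j u j 0 * v j 0.

Definition sqnorm v : R := dotv v v.

Definition quad A v : R := (v^T *m A *m v) 0 0.

Lemma dotvC u v : dotv u v = dotv v u.
Proof. by apply: eq_bigr => j _; rewrite mulrC. Qed.

Lemma dotvE u v : dotv u v = (u^T *m v) 0 0.
Proof. by rewrite mxE; apply: eq_bigr => j _; rewrite mxE. Qed.

Lemma mulmx_dotv n (X : 'M[R]_(n, d)) v i : (X *m v) i 0 = dotv (row i X)^T v.
Proof. by rewrite mxE; apply: eq_bigr => j _; rewrite !mxE. Qed.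

Lemma quad_pair A v :
  quad A v = \sum_(s : 'I_d * 'I_d) v s.1 0 * v s.2 0 * A s.1 s.2.
Proof.
rewrite -(pair_big xpredT xpredT (fun i j => v i 0 * v j 0 * A i j)) /=.
rewrite exchange_big /quad mxE; apply: eq_bigr => j _.
by rewrite mxE mulr_suml; apply: eq_bigr => i _; rewrite mxE mulrAC.
Qed.

Lemma quad1 v : quad 1%:M v = sqnorm v.
Proof. by rewrite /quad mulmx1 -dotvE. Qed.

Lemma quad_outer u v : quad (u *m u^T) v = dotv u v ^+ 2.
Proof.
by rewrite /quad mulmxA -mulmxA mxE big_ord1 -!dotvE dotvC -expr2.
Qed.

Lemma quad_gram n (X : 'M[R]_(n, d)) (c : 'rV[R]_n) v :
  quad (X^T *m diag_mx c *m X) v = \sum_i c 0 i * (X *m v) i 0 ^+ 2.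
Proof.
rewrite /quad !mulmxA -trmx_mul -2!mulmxA mul_diag_mx mxE.
by apply: eq_bigr => i _; rewrite !mxE expr2 mulrCA.
Qed.

Lemma trace_outer_sqr u : \tr ((u *m u^T) *m (u *m u^T)^T) = sqnorm u ^+ 2.
Proof.
rewrite trmx_mul trmxK mulmxA mxtrace_mulC !mulmxA -mulmxA trace_mx11 mxE.
by rewrite big_ord1 -dotvE -expr2.
Qed.

End DotProduct.

Section SquaredNorm.
Variables (R : realDomainType) (d : nat).
Implicit Type v : 'cV[R]_d.

Lemma sqnorm_ge0 v : 0 <= sqnorm v.
Proof. by apply: sumr_ge0 => j _; rewrite -expr2 sqr_ge0. Qed.

Lemma sqnorm_eq0 v : (sqnorm v == 0) = (v == 0).
Proof.
apply/eqP/eqP => [v0|->]; last first.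
  by rewrite /sqnorm /dotv big1// => j _; rewrite mxE mul0r.
apply/colP => j; apply/eqP; rewrite mxE -sqrf_eq0 expr2.
by rewrite (psumr_eq0P _ v0)// => i _; rewrite -expr2 sqr_ge0.
Qed.

Lemma sqnorm_gt0 v : (0 < sqnorm v) = (v != 0).
Proof. by rewrite lt_def sqnorm_ge0 sqnorm_eq0 andbT. Qed.

End SquaredNorm.

Lemma cauchy_schwarz_quad (R : realFieldType) (I : finType) (d : nat)
    (c : I -> R) (x : I -> 'cV[R]_d) (B : 'M[R]_d) (m : nat) :
  (\sum_k c k * quad B (x k) ^+ m) ^+ 2 <=
  (\sum_k \sum_l c k * c l * dotv (x k) (x l) ^+ 2 ^+ m) *
  \tr (B *m B^T) ^+ m.
Proof.
have := cauchy_schwarz_tensor c (fun k (s : 'I_d * 'I_d) => x k s.1 0 * x k s.2 0)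
  (fun s => B s.1 s.2) m.
congr (_ ^+ _ <= _ * _ ^+ _).
- by apply: eq_bigr => k _; rewrite quad_pair.
- apply: eq_bigr => k _; apply: eq_bigr => l _; congr (_ * _ ^+ _).
  by rewrite expr2 big_distrlr pair_big; apply: eq_bigr => s _; rewrite mulrACA.
- rewrite -(pair_big xpredT xpredT (fun i j => B i j ^+ 2)).
  apply: eq_bigr => i _; rewrite [RHS]mxE.
  by apply: eq_bigr => j _; rewrite mxE expr2.
Qed.

Lemma orthonormal_eigenbasis_max (R : realFieldType) (d : nat) (G U : 'M[R]_d)
    (L : 'rV[R]_d) (t : 'I_d) :
  U^T *m U = 1%:M -> G *m U = U *m diag_mx L -> (forall j, L 0 j <= L 0 t) ->
  sqnorm (col t U) = 1 /\
  forall v : 'cV[R]_d, quad G v <= sqnorm v * quad G (col t U).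
Proof.
move=> UU GU L_max; have UU' : U *m U^T = 1%:M by exact: mulmx1C.
have coordE : U^T *m col t U = col t 1%:M by rewrite -UU !colE mulmxA.
have quadE v : quad G v = \sum_j L 0 j * (U^T *m v) j 0 ^+ 2.
  by rewrite -quad_gram trmxK -GU -mulmxA UU' mulmx1.
have quad_col : quad G (col t U) = L 0 t.
  rewrite quadE coordE (bigD1 t)//= big1 => [|j /negPf jt]; rewrite !mxE.
    by rewrite eqxx expr1n mulr1 addr0.
  by rewrite jt expr0n mulr0.
split=> [|v].
  have -> : sqnorm (col t U) = (U^T *m U) t t.
    by rewrite mxE; apply: eq_bigr => j _; rewrite !mxE.
  by rewrite UU mxE eqxx.
have -> : sqnorm v = sqnorm (U^T *m v).
  by rewrite /sqnorm !dotvE trmx_mul trmxK mulmxA -(mulmxA v^T) UU' mulmx1.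
rewrite quadE quad_col mulr_suml; apply: ler_sum => j _.
by rewrite -expr2 mulrC ler_wpM2l ?sqr_ge0.
Qed.

(** * Rows as approximate maximizers of power sums *)

Section PowerSums.
Variables (R : realFieldType) (n d : nat) (X : 'M[R]_(n, d)) (m : nat).
Implicit Types u v w : 'cV[R]_d.

Local Notation rowv k := (row k X)^T.

Definition power_sum k v : R := \sum_i (X *m v) i 0 ^+ 2 ^+ k.

Definition weighted_form u v : R :=
  \sum_i (X *m u) i 0 ^+ 2 ^+ m * (X *m v) i 0 ^+ 2.

Definition row_form_sum v : R := \sum_k (X *m v) k 0 ^+ 2 * weighted_form (rowv k) v.

Lemma power_sum_ge0 k v : 0 <= power_sum k v.
Proof. by apply: sumr_ge0 => i _; rewrite exprn_ge0// sqr_ge0. Qed.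

Lemma weighted_form_ge0 u v : 0 <= weighted_form u v.
Proof. by apply: sumr_ge0 => i _; rewrite mulr_ge0 ?sqr_ge0// exprn_ge0 ?sqr_ge0. Qed.

Lemma row_form_sum_ge0 v : 0 <= row_form_sum v.
Proof. by apply: sumr_ge0 => k _; rewrite mulr_ge0 ?sqr_ge0 ?weighted_form_ge0. Qed.

Lemma cauchy_schwarz_rows v (B : 'M[R]_d) :
  (\sum_k (X *m v) k 0 ^+ 2 * quad B (rowv k) ^+ m) ^+ 2 <=
  row_form_sum v * \tr (B *m B^T) ^+ m.
Proof.
have := cauchy_schwarz_quad (fun k => (X *m v) k 0 ^+ 2) (fun k => rowv k) B m.
congr (_ <= _ * _); apply: eq_bigr => k _; rewrite mulr_sumr.
apply: eq_bigr => l _; rewrite [(X *m rowv k) l 0]mulmx_dotv dotvC -mulrA.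
by congr (_ * _); rewrite mulrC.
Qed.

Lemma power_sum_sqr_le v :
  power_sum m.+1 v ^+ 2 <= row_form_sum v * (sqnorm v ^+ m) ^+ 2.
Proof.
have := cauchy_schwarz_rows v (v *m v^T).
rewrite trace_outer_sqr exprAC; congr (_ ^+ _ <= _).
by apply: eq_bigr => k _; rewrite quad_outer dotvC -mulmx_dotv -exprS.
Qed.

Lemma row_norms_sqr_le v :
  (\sum_k (X *m v) k 0 ^+ 2 * sqnorm (rowv k) ^+ m) ^+ 2 <=
  row_form_sum v * d%:R ^+ m.
Proof.
have := cauchy_schwarz_rows v 1%:M.
rewrite trmx1 mulmx1 mxtrace1; congr (_ ^+ _ <= _).
by apply: eq_bigr => k _; rewrite quad1.
Qed.

Lemma weighted_form_le_power_sum u w : u != 0 -> w != 0 ->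
  exists2 z, z \in [:: u; w] &
    weighted_form u w * sqnorm z ^+ m.+1 <=
    sqnorm u ^+ m * sqnorm w * power_sum m.+1 z.
Proof.
rewrite -!sqnorm_gt0 => u_gt0 w_gt0.
pose value z := power_sum m.+1 z / sqnorm z ^+ m.+1.
have amgm : m.+1%:R * (weighted_form u w / (sqnorm u ^+ m * sqnorm w)) <=
    m%:R * value u + value w.
  rewrite /value /weighted_form /power_sum !mulr_suml !mulr_sumr -big_split.
  apply: ler_sum => i _ /=; set y := _ ^+ 2; set z := (X *m w) _ _ ^+ 2.
  have := @weighted_amgm R m (y / sqnorm u) (z / sqnorm w).
  rewrite !divr_ge0 ?sqr_ge0 ?sqnorm_ge0// => /(_ isT isT).
  by rewrite !expr_div_n mulf_div -mulr_sumr.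
suff [z z_uw z_max] : exists2 z, z \in [:: u; w] &
    m%:R * value u + value w <= m.+1%:R * value z.
  have z_gt0 : 0 < sqnorm z by move: z_uw; rewrite !inE => /orP[]/eqP ->.
  exists z => //; have := le_trans amgm z_max; rewrite ler_pM2l ?ltr0n//.
  rewrite ler_pdivrMr ?mulr_gt0 ?exprn_gt0// mulrAC ler_pdivlMr ?exprn_gt0//.
  by rewrite [leRHS]mulrC.
have [uw|/ltW wu] := leP (value u) (value w).
  by exists w; rewrite ?inE ?eqxx ?orbT// -natr1 mulrDl mul1r lerD2r ler_wpM2l.
by exists u; rewrite ?inE ?eqxx// -natr1 mulrDl mul1r lerD2l.
Qed.

End PowerSums.

Section RowCandidates.
Variables (R : rcfType) (n d : nat) (X : 'M[R]_(n, d)) (m : nat).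
Implicit Types u v w : 'cV[R]_d.

Local Notation rowv k := (row k X)^T.

Lemma power_sum_row_norms_le v :
  power_sum X m.+1 v * (\sum_k (X *m v) k 0 ^+ 2 * sqnorm (rowv k) ^+ m) <=
  Num.sqrt d%:R ^+ m * sqnorm v ^+ m * row_form_sum X m v.
Proof.
have form_sum_ge0 := row_form_sum_ge0 X m v.
have rows_ge0 : 0 <= \sum_k (X *m v) k 0 ^+ 2 * sqnorm (rowv k) ^+ m.
  by apply: sumr_ge0 => k _; rewrite mulr_ge0 ?sqr_ge0// exprn_ge0 ?sqnorm_ge0.
have nneg := (exprn_ge0, sqrtr_ge0, sqnorm_ge0, power_sum_ge0, form_sum_ge0, rows_ge0,
  mulr_ge0).
rewrite -ler_sqr ?nnegrE ?nneg//.
have := ler_pM (sqr_ge0 _) (sqr_ge0 _)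
  (power_sum_sqr_le X m v) (row_norms_sqr_le X m v).
rewrite -exprMn; congr (_ <= _).
rewrite !exprMn [Num.sqrt _ ^+ m ^+ 2]exprAC sqr_sqrtr ?ler0n//; ring.
Qed.

Lemma exists_row_power_sum_le v : power_sum X m.+1 v != 0 ->
  exists2 k, row k X != 0 &
    power_sum X m.+1 v * sqnorm (rowv k) ^+ m <=
    Num.sqrt d%:R ^+ m * sqnorm v ^+ m * weighted_form X m (rowv k) v.
Proof.
move=> F_neq0; have [k|||k ck Fk] := exists_le_of_weighted_sum_le
  (c := fun k => (X *m v) k 0 ^+ 2)
  (a := fun k => power_sum X m.+1 v * sqnorm (rowv k) ^+ m)
  (b := fun k => Num.sqrt d%:R ^+ m * sqnorm v ^+ m * weighted_form X m (rowv k) v).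
- exact: sqr_ge0.
- have [i] : exists i, true && (0 < (X *m v) i 0 ^+ 2 ^+ m.+1).
    by apply/psumr_neq0P/eqP => // i _; rewrite exprn_ge0 ?sqr_ge0.
  move=> Fi; exists i; rewrite lt_def sqr_ge0 andbT.
  by apply: contraTneq Fi => ->; rewrite expr0n ltxx.
- under eq_bigr do rewrite mulrCA.
  under [leRHS]eq_bigr do rewrite mulrCA.
  rewrite -!mulr_sumr; exact: power_sum_row_norms_le.
- exists k => //; apply: contraTneq ck; rewrite mulmx_dotv => ->.
  by rewrite /dotv big1 ?expr0n ?ltxx// => j _; rewrite !mxE mul0r.
Qed.

(* [w] maximizes the Rayleigh quotient of the form weighted by the row [u]. *)
Definition row_eigen_pair k u w :=
  [/\ u != 0, row k X != 0 -> u = rowv k, w != 0 &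
      forall v, weighted_form X m u v * sqnorm w <= sqnorm v * weighted_form X m u w].

Lemma row_eigen_pair_gram k u (U : 'M[R]_d) (L : 'rV[R]_d) (t : 'I_d) :
  let G := X^T *m diag_mx (\row_i (X *m u) i 0 ^+ 2 ^+ m) *m X in
  u != 0 -> (row k X != 0 -> u = rowv k) ->
  U^T *m U = 1%:M -> G *m U = U *m diag_mx L -> (forall j, L 0 j <= L 0 t) ->
  row_eigen_pair k u (col t U).
Proof.
move=> G u_neq0 uE UU GU L_max.
have weighted_formE v : weighted_form X m u v = quad G v.
  by rewrite quad_gram; apply: eq_bigr => i _; rewrite [in RHS]mxE.
have [col_unit col_max] := orthonormal_eigenbasis_max UU GU L_max.
split=> //; first by rewrite -sqnorm_gt0 col_unit.
by move=> v; rewrite col_unit mulr1 !weighted_formE.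
Qed.

Lemma row_eigen_pairs_approx (u w : 'I_n -> 'cV[R]_d) v :
  (0 < n)%N -> (forall k, row_eigen_pair k (u k) (w k)) ->
  exists k, exists2 z, z \in [:: u k; w k] &
    power_sum X m.+1 v * sqnorm z ^+ m.+1 <=
    Num.sqrt d%:R ^+ m * sqnorm v ^+ m.+1 * power_sum X m.+1 z.
Proof.
move=> n_gt0 pairs; have [F0|] := eqVneq (power_sum X m.+1 v) 0.
  exists (Ordinal n_gt0), (u (Ordinal n_gt0)); rewrite ?inE ?eqxx//.
  by rewrite F0 mul0r !mulr_ge0 ?exprn_ge0 ?sqrtr_ge0 ?sqnorm_ge0 ?power_sum_ge0.
move=> /exists_row_power_sum_le [k k_neq0]; set e := _ * sqnorm v ^+ m => row_le.
have [u_neq0 /(_ k_neq0) uE w_neq0 rayleigh_le] := pairs k; rewrite -uE in row_le.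
have [z z_uw z_le] := weighted_form_le_power_sum X m u_neq0 w_neq0.
have e_ge0 : 0 <= e by rewrite mulr_ge0 ?exprn_ge0 ?sqrtr_ge0 ?sqnorm_ge0.
exists k, z => //; rewrite [sqnorm v ^+ _]exprSr mulrA -(mulrA e).
have U_gt0 : 0 < sqnorm (u k) ^+ m by rewrite exprn_gt0 ?sqnorm_gt0.
have Z_ge0 := exprn_ge0 m.+1 (sqnorm_ge0 z).
apply: (cross_le_trans U_gt0 e_ge0 Z_ge0 row_le); rewrite mulrCA.
apply: (cross_le_trans _ (sqnorm_ge0 v) Z_ge0 (rayleigh_le v)); rewrite ?sqnorm_gt0//.
by rewrite mulrCA mulrA.
Qed.

End RowCandidates.

(** * Lp norms *)

Section PowerMeans.
Variable R : realType.

Lemma weighted_amgm_powR (x a r : R) : 0 <= x -> 0 <= a -> 0 < r <= 1 ->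
  x `^ r * a `^ (1 - r) <= r * x + (1 - r) * a.
Proof.
move=> x_ge0 a_ge0 /andP[r_gt0]; rewrite le_eqVlt => /predU1P[->|r_lt1].
  by rewrite subrr powRr0 powRr1// mulr1 mul1r mul0r addr0.
have r'_gt0 : 0 < 1 - r by rewrite subr_gt0.
have := @conjugate_powR _ (x `^ r) (a `^ (1 - r)) r^-1 (1 - r)^-1
  (powR_ge0 _ _) (powR_ge0 _ _).
rewrite !invr_gt0 !invrK -!powRrM !divff ?gt_eqF// !powRr1// subrKC.
by move=> /(_ r_gt0 r'_gt0 erefl); rewrite [x * r]mulrC [a * _]mulrC.
Qed.

Variable I : finType.
Implicit Type x : I -> R.

Lemma powR_sum_le x r : (forall i, 0 <= x i) -> 0 < r <= 1 ->
  (\sum_i x i) `^ r <= \sum_i x i `^ r.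
Proof.
move=> x_ge0 /andP[r_gt0 r_le1]; set S := \sum_i x i.
have [S0|S_neq0] := eqVneq S 0.
  by rewrite S0 powR0 ?gt_eqF// sumr_ge0// => i _; exact: powR_ge0.
have S_gt0 : 0 < S by rewrite lt_def S_neq0 sumr_ge0.
have xS_ge0 i : 0 <= x i / S by rewrite divr_ge0// ltW.
have -> : \sum_i x i `^ r = S `^ r * \sum_i (x i / S) `^ r.
  rewrite mulr_sumr; apply: eq_bigr => i _.
  by rewrite -powRM ?(ltW S_gt0)// mulrC divfK.
rewrite ler_peMr ?powR_ge0//.
have {1}-> : 1 = \sum_i x i / S by rewrite -mulr_suml divff.
apply: ler_sum => i _; have [->|xS_neq0] := eqVneq (x i / S) 0; first exact: powR_ge0.
rewrite ger1_powR// lt_def xS_neq0 xS_ge0 /= ler_pdivrMr// mul1r.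
by rewrite /S (bigD1 i)//= lerDl sumr_ge0.
Qed.

Lemma sum_powR_le x r : (forall i, 0 <= x i) -> 0 < r <= 1 ->
  \sum_i x i `^ r <= #|I|%:R `^ (1 - r) * (\sum_i x i) `^ r.
Proof.
move=> x_ge0 r01; have /andP[r_gt0 r_le1] := r01; set S := \sum_i x i.
have [S0|S_neq0] := eqVneq S 0.
  rewrite big1 ?mulr_ge0 ?powR_ge0// => i _.
  by rewrite (psumr_eq0P _ S0)// powR0 ?gt_eqF.
have S_gt0 : 0 < S by rewrite lt_def S_neq0 sumr_ge0.
have I_gt0 : 0 < #|I|%:R :> R.
  rewrite ltr0n; apply/card_gt0P; apply: contrapT => noI.
  by case/eqP: S_neq0; apply: big1 => i; case: noI; exists i.
pose a := S / #|I|%:R; have a_gt0 : 0 < a by rewrite divr_gt0.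
have SE : S = #|I|%:R * a by rewrite mulrC divfK ?gt_eqF.
rewrite -(ler_pM2r (powR_gt0 (1 - r) a_gt0)) mulrAC.
rewrite -powRM ?(ltW I_gt0) ?(ltW a_gt0)// -SE -powRD ?S_neq0 ?implybT// subrK powRr1 ?(ltW S_gt0)//.
have -> : S = \sum_i (r * x i + (1 - r) * a).
  rewrite big_split /= -mulr_sumr sumr_const -/S -[_ *+ _]mulr_natl mulrCA -SE.
  by rewrite -mulrDl subrKC mul1r.
by rewrite mulr_suml; apply: ler_sum => i _; rewrite weighted_amgm_powR// ltW.
Qed.

End PowerMeans.

Section LpNorms.
Variable R : realType.

Lemma sqr_powR (x r : R) : (x ^+ 2) `^ (r / 2) = `|x| `^ r.
Proof.
by rewrite -real_normK ?num_real// -powR_mulrn// -powRrM mulrCA divff ?mulr1.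
Qed.

Variable k : nat.
Implicit Types v z : 'cV[R]_k.

Lemma lpnorm_ge0 (p : R) v : 0 <= lpnorm p v.
Proof. exact: powR_ge0. Qed.

Lemma sum_powR_ge0 (p : R) v : 0 <= \sum_i `|v i 0| `^ p.
Proof. by apply: sumr_ge0 => i _; exact: powR_ge0. Qed.

Lemma lpnorm_gt0 (p : R) v : 0 < p -> v != 0 -> 0 < lpnorm p v.
Proof.
move=> p_gt0 v_neq0; rewrite lt_def lpnorm_ge0 andbT; apply: contra v_neq0.
move=> /eqP/powR_eq0_eq0/psumr_eq0P sum_eq0; apply/eqP/colP => i; rewrite mxE.
by apply/eqP; rewrite -normr_eq0; apply/eqP/(@powR_eq0_eq0 _ _ p)/sum_eq0.
Qed.

Lemma lpnormZ (p c : R) v : 0 < p -> 0 <= c -> lpnorm p (c *: v) = c * lpnorm p v.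
Proof.
move=> p_gt0 c_ge0; rewrite /lpnorm.
under eq_bigr do rewrite mxE normrM powRM// ger0_norm//.
rewrite -mulr_sumr powRM ?powR_ge0 ?sum_powR_ge0// -powRrM divff ?gt_eqF//.
by rewrite powRr1.
Qed.

Lemma lpnorm_normalize (p : R) v : 0 < p -> v != 0 ->
  lpnorm p ((lpnorm p v)^-1 *: v) = 1.
Proof.
move=> p_gt0 v_neq0; rewrite lpnormZ ?invr_ge0 ?lpnorm_ge0// mulVf//.
by rewrite gt_eqF ?lpnorm_gt0.
Qed.

Lemma sum_powR_div (r s : R) v : s != 0 ->
  \sum_i `|v i 0| `^ r = \sum_i (`|v i 0| `^ s) `^ (r / s).
Proof. by move=> s_neq0; apply: eq_bigr => i _; rewrite -powRrM mulrC divfK. Qed.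

Lemma lpnorm_le (r s : R) v : 0 < r -> r <= s -> lpnorm s v <= lpnorm r v.
Proof.
move=> r_gt0 r_le_s; have s_gt0 := lt_le_trans r_gt0 r_le_s.
have sE : s^-1 = r / s * r^-1 by rewrite mulrAC divff ?gt_eqF// mul1r.
rewrite /lpnorm sE powRrM.
rewrite ge0_ler_powR ?nnegrE ?invr_ge0 ?powR_ge0 ?sum_powR_ge0 ?(ltW r_gt0)//.
rewrite (sum_powR_div r v (lt0r_neq0 s_gt0)).
by rewrite powR_sum_le// divr_gt0// ler_pdivrMr// mul1r.
Qed.

Lemma lpnorm_le_dim (r s : R) v : 0 < r -> r <= s ->
  lpnorm r v <= k%:R `^ (r^-1 - s^-1) * lpnorm s v.
Proof.
move=> r_gt0 r_le_s; have s_gt0 := lt_le_trans r_gt0 r_le_s.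
have r_neq0 := lt0r_neq0 r_gt0.
have dimE : r^-1 - s^-1 = (1 - r / s) * r^-1.
  by rewrite mulrBl mul1r mulrAC divff ?mul1r.
have sE : s^-1 = r / s * r^-1 by rewrite mulrAC divff ?mul1r.
rewrite dimE /lpnorm [X in _ <= _ * _ `^ X]sE.
rewrite [k%:R `^ _]powRrM [X in _ * X]powRrM -powRM ?powR_ge0//.
rewrite ge0_ler_powR ?nnegrE ?invr_ge0 ?mulr_ge0 ?powR_ge0 ?sum_powR_ge0
  ?(ltW r_gt0)//.
rewrite (sum_powR_div r v (lt0r_neq0 s_gt0)) -[X in X%:R `^ _]card_ord.
by rewrite sum_powR_le// divr_gt0// ler_pdivrMr// mul1r.
Qed.

Lemma lpnorm2 v : lpnorm 2 v = sqnorm v `^ 2^-1.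
Proof.
congr (_ `^ _); apply: eq_bigr => i _.
by rewrite -sqr_powR divff// powRr1 ?sqr_ge0.
Qed.

Lemma lpnorm_even (n m : nat) (X : 'M[R]_(n, k)) v :
  lpnorm (2 * m)%:R (X *m v) = power_sum X m v `^ (2 * m)%:R^-1.
Proof.
congr (_ `^ _); apply: eq_bigr => i _.
by rewrite -sqr_powR natrM mulrAC divff// mul1r powR_mulrn// sqr_ge0.
Qed.

Lemma lpnorm_l2_distortion (p : R) v z : 1 <= p ->
  lpnorm 2 v * lpnorm p z <=
  k%:R `^ gamma_exp p * (lpnorm p v * lpnorm 2 z).
Proof.
move=> p_ge1; have p_gt0 : 0 < p by exact: lt_le_trans p_ge1.
rewrite /gamma_exp; case: (leP p 2) => [p_le2|/ltW p_ge2].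
  rewrite [leRHS]mulrCA; apply: ler_pM; try exact: lpnorm_ge0.
    exact: lpnorm_le.
  exact: lpnorm_le_dim.
rewrite [leRHS]mulrA; apply: ler_pM; try exact: lpnorm_ge0.
  exact: lpnorm_le_dim.
exact: lpnorm_le.
Qed.

End LpNorms.

Section Approximation.
Variables (R : realType) (n d : nat) (X : 'M[R]_(n, d)).
Implicit Types u v w z : 'cV[R]_d.

Definition norm_ratio (p : R) (q : nat) v : R := lpnorm q%:R (X *m v) / lpnorm p v.

(* [norm_ratio p q v <= D * norm_ratio p q z], without the divisions. *)
Definition dominates (p : R) (q : nat) (D : R) z v :=
  lpnorm q%:R (X *m v) * lpnorm p z <= D * lpnorm p v * lpnorm q%:R (X *m z).

Lemma dominates_powR (m : nat) (c : R) z v : 0 <= c ->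
  power_sum X m.+1 v * sqnorm z ^+ m.+1 <=
  c * sqnorm v ^+ m.+1 * power_sum X m.+1 z ->
  dominates 2 (2 * m.+1) (c `^ (2 * m.+1)%:R^-1) z v.
Proof.
move=> c_ge0; have q_ge0 : 0 <= (2 * m.+1)%:R^-1 :> R by rewrite invr_ge0.
have sqnorm_powR y : (sqnorm y ^+ m.+1) `^ (2 * m.+1)%:R^-1 = lpnorm 2 y.
  rewrite lpnorm2 -powR_mulrn ?sqnorm_ge0// -powRrM; congr (_ `^ _).
  by rewrite natrM invfM mulrCA divff ?mulr1// pnatr_eq0.
have nneg := (exprn_ge0, sqnorm_ge0, power_sum_ge0, c_ge0, mulr_ge0).
move=> /(ge0_ler_powR q_ge0); rewrite !nnegrE !nneg// => /(_ isT isT).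
by rewrite !powRM ?nneg// !sqnorm_powR -!lpnorm_even.
Qed.

Lemma dominates_lpnorm (p : R) (q : nat) (D : R) z v : 1 <= p -> 0 <= D -> z != 0 ->
  dominates 2 q D z v -> dominates p q (d%:R `^ gamma_exp p * D) z v.
Proof.
move=> p_ge1 D_ge0 z_neq0; rewrite /dominates => dom; rewrite mulrAC in dom.
have -> : d%:R `^ gamma_exp p * D * lpnorm p v * lpnorm q%:R (X *m z) =
    D * lpnorm q%:R (X *m z) * (d%:R `^ gamma_exp p * lpnorm p v) by ring.
apply: (cross_le_trans _ _ (lpnorm_ge0 p z) dom); first exact: lpnorm_gt0.
  by rewrite mulr_ge0 ?lpnorm_ge0.
by rewrite [leRHS]mulrC -mulrA lpnorm_l2_distortion.
Qed.

Lemma approx_factor_even (p : R) (m : nat) : (0 < d)%N ->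
  approx_factor p (2 * m.+1) d =
  d%:R `^ gamma_exp p * (Num.sqrt d%:R ^+ m) `^ (2 * m.+1)%:R^-1.
Proof.
move=> d_gt0; rewrite /approx_factor -addrA powRD ?pnatr_eq0 -?lt0n ?d_gt0 ?implybT//.
congr (_ * _); rewrite -powR12_sqrt// -powR_mulrn ?powR_ge0// -!powRrM.
congr (_ `^ _); rewrite natrM -natr1; field.
by rewrite nat1r pnatr_eq0.
Qed.

Definition approximating (p : R) (q : nat) (D : R) (L : seq 'cV[R]_d) :=
  {in L, forall z, z != 0} /\ forall v, exists2 z, z \in L & dominates p q D z v.

Lemma row_eigen_pairs_approximating (p : R) (m : nat) (u w : 'I_n -> 'cV[R]_d) :
  1 <= p -> (0 < n)%N -> (0 < d)%N ->
  (forall k, row_eigen_pair X m k (u k) (w k)) ->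
  approximating p (2 * m.+1) (approx_factor p (2 * m.+1) d) (codom u ++ codom w).
Proof.
move=> p_ge1 n_gt0 d_gt0 pairs.
have L_neq0 : {in codom u ++ codom w, forall z, z != 0}.
  by move=> z; rewrite mem_cat => /orP[]/codomP[k ->]; case: (pairs k).
split=> // v; have [k [z z_uw z_le]] := row_eigen_pairs_approx v n_gt0 pairs.
have z_in : z \in codom u ++ codom w.
  by move: z_uw; rewrite mem_cat !inE => /orP[]/eqP ->; rewrite codom_f ?orbT.
exists z => //; rewrite approx_factor_even//.
apply: dominates_lpnorm => //; first exact: L_neq0.
by apply: dominates_powR => //; rewrite exprn_ge0 ?sqrtr_ge0.
Qed.

Section OperatorNorm.
Variables (p : R) (q : nat) (D : R) (L : seq 'cV[R]_d).
Hypotheses (p_gt0 : 0 < p) (q_gt0 : (0 < q)%N) (D_ge0 : 0 <= D).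
Hypothesis L_approx : approximating p q D L.

Lemma norm_ratio_ge0 v : 0 <= norm_ratio p q v.
Proof. by rewrite divr_ge0 ?lpnorm_ge0. Qed.

Lemma norm_ratio_normalize z :
  lpnorm q%:R (X *m ((lpnorm p z)^-1 *: z)) = norm_ratio p q z.
Proof. by rewrite -scalemxAr lpnormZ ?ltr0n ?invr_ge0 ?lpnorm_ge0// mulrC. Qed.

Lemma lpnorm_mul_le_max_ratio v : lpnorm p v = 1 ->
  lpnorm q%:R (X *m v) <= D * max_ratio p q X L.
Proof.
move=> v_unit; have [L_neq0 /(_ v) [z z_in]] := L_approx.
rewrite /dominates v_unit mulr1 -ler_pdivlMr ?lpnorm_gt0 ?L_neq0// -mulrA.
move=> /le_trans; apply; rewrite ler_wpM2l//.
exact: (le_bigmax_seq _ _ xpredT (norm_ratio p q)).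
Qed.

Lemma norm_ratio_le_opnorm z : z != 0 -> norm_ratio p q z <= opnorm p q%:R X.
Proof.
move=> z_neq0; rewrite -norm_ratio_normalize; apply: ub_le_sup.
  exists (D * max_ratio p q X L) => _ [v /= v_unit <-].
  exact: lpnorm_mul_le_max_ratio.
by exists ((lpnorm p z)^-1 *: z) => //=; exact: lpnorm_normalize.
Qed.

Lemma opnorm_le_max_ratio : opnorm p q%:R X <= D * max_ratio p q X L.
Proof.
have [L_neq0 /(_ 0) [z /L_neq0 z_neq0 _]] := L_approx.
apply: ge_sup; last by move=> _ [v /= v_unit <-]; exact: lpnorm_mul_le_max_ratio.
by eexists; exists ((lpnorm p z)^-1 *: z) => //=; exact: lpnorm_normalize.
Qed.

Lemma max_ratio_le_opnorm : max_ratio p q X L <= opnorm p q%:R X.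
Proof.
have [L_neq0 /(_ 0) [z /L_neq0 z_neq0 _]] := L_approx.
rewrite /max_ratio big_seq; apply: bigmax_le => [|v /L_neq0].
  exact: le_trans (norm_ratio_ge0 z) (norm_ratio_le_opnorm z_neq0).
exact: norm_ratio_le_opnorm.
Qed.

End OperatorNorm.

End Approximation.

(** * Reasoning about programs *)

Arguments CSkip {R}.
Arguments CISet {R}.
Arguments CEig {R}.
Arguments RGet {R}.
Arguments RNat {R}.

Section ProgramLogic.
Variables (R : realType) (eig : eig_fun R).
Implicit Types (s : state R) (c : cmd R).

Fixpoint written_regs c : seq nat :=
  match c with
  | CSkip | CRSet _ _ _ _ | CEig _ _ _ _ => [::]
  | CSeq c1 c2 | CIfLe _ _ c1 c2 => written_regs c1 ++ written_regs c2
  | CISet x _ => [:: x]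
  | CFor x _ c1 => x :: written_regs c1
  end.

Fixpoint written_arrays c : seq nat :=
  match c with
  | CSkip | CISet _ _ => [::]
  | CSeq c1 c2 | CIfLe _ _ c1 c2 => written_arrays c1 ++ written_arrays c2
  | CRSet a _ _ _ => [:: a]
  | CFor _ _ c1 => written_arrays c1
  | CEig _ _ b b' => [:: b; b']
  end.

Definition agree_outside (xs bs : seq nat) s s' :=
  (forall x, x \notin xs -> ireg s x = ireg s' x) /\
  (forall a, a \notin bs -> rmem s a = rmem s' a).

Lemma agree_outside_refl xs bs s : agree_outside xs bs s s.
Proof. by []. Qed.

Lemma agree_outside_trans xs bs s1 s2 s3 :
  agree_outside xs bs s1 s2 -> agree_outside xs bs s2 s3 ->
  agree_outside xs bs s1 s3.
Proof.
move=> [regs12 mem12] [regs23 mem23].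
by split => x x_out; rewrite ?regs12 ?regs23 ?mem12 ?mem23.
Qed.

Lemma agree_outside_sub xs bs xs' bs' s s' :
  {subset xs <= xs'} -> {subset bs <= bs'} ->
  agree_outside xs bs s s' -> agree_outside xs' bs' s s'.
Proof.
move=> sub_xs sub_bs [regs mem]; split => x x_out.
  by apply: regs; apply: contra x_out => /sub_xs.
by apply: mem; apply: contra x_out => /sub_bs.
Qed.

Lemma agree_outside_set_ireg xs bs x k s :
  x \in xs -> agree_outside xs bs (set_ireg x k s) s.
Proof.
by move=> x_in; split=> // y y_out /=; case: eqP => // yx; rewrite yx x_in in y_out.
Qed.

Lemma agree_outside_set_array xs bs a A s :
  a \in bs -> agree_outside xs bs (set_array a A s) s.
Proof.
by move=> a_in; split=> // b b_out /=; case: eqP => // ba; rewrite ba a_in in b_out.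
Qed.

Lemma iteri_agree_outside x c s k :
  (forall s', agree_outside (written_regs c) (written_arrays c) (exec eig c s') s') ->
  agree_outside (x :: written_regs c) (written_arrays c)
    (iteri k (fun l s' => exec eig c (set_ireg x l s')) s) s.
Proof.
move=> agree_c; elim: k => [|k IH] /=; first exact: agree_outside_refl.
apply: agree_outside_trans IH.
apply: agree_outside_trans (agree_outside_set_ireg _ _ _ (mem_head _ _)).
by apply: agree_outside_sub (agree_c _) => // y y_in; rewrite inE y_in orbT.
Qed.

Lemma exec_agree_outside c s :
  agree_outside (written_regs c) (written_arrays c) (exec eig c s) s.
Proof.
elim: c s => [|c1 IH1 c2 IH2|x e|a e1 e2 e|e1 e2 c1 IH1 c2 IH2|x e c IH|a e b b'] s.
- exact: agree_outside_refl.
- apply: (@agree_outside_trans _ _ _ (exec eig c1 s)).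
    by apply: agree_outside_sub (IH2 _) => y y_in; rewrite mem_cat y_in orbT.
  by apply: agree_outside_sub (IH1 _) => y y_in; rewrite mem_cat y_in.
- by apply: agree_outside_set_ireg; rewrite inE.
- by apply: agree_outside_set_array; rewrite inE.
- rewrite /=; case: ifP => _.
    by apply: agree_outside_sub (IH1 _) => y y_in; rewrite mem_cat y_in.
  by apply: agree_outside_sub (IH2 _) => y y_in; rewrite mem_cat y_in orbT.
- exact: iteri_agree_outside.
- rewrite /= /exec_eig; set s' := set_array b _ s.
  by apply: (@agree_outside_trans _ _ _ s'); apply: agree_outside_set_array;
     rewrite !inE eqxx ?orbT.
Qed.

Lemma exec_ireg c s x : x \notin written_regs c -> ireg (exec eig c s) x = ireg s x.
Proof. exact: (exec_agree_outside c s).1. Qed.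

Lemma exec_rmem c s a : a \notin written_arrays c -> rmem (exec eig c s) a = rmem s a.
Proof. exact: (exec_agree_outside c s).2. Qed.

Lemma exec_seq c1 c2 s : exec eig (CSeq c1 c2) s = exec eig c2 (exec eig c1 s).
Proof. by []. Qed.

Lemma time_seq c1 c2 s :
  time eig (CSeq c1 c2) s = (time eig c1 s + time eig c2 (exec eig c1 s)).+1.
Proof. by []. Qed.

Lemma exec_for_ind (Inv : nat -> state R -> Prop) N x e c s :
  ieval s e = N -> Inv 0%N s ->
  (forall (k : 'I_N) s',
     agree_outside (x :: written_regs c) (written_arrays c) s' s ->
     Inv k s' -> Inv k.+1 (exec eig c (set_ireg x k s'))) ->
  Inv N (exec eig (CFor x e c) s).
Proof.
move=> eN Inv0 InvS /=; rewrite eN; suff: forall k, (k <= N)%N ->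
    Inv k (iteri k (fun l s' => exec eig c (set_ireg x l s')) s) by exact.
elim=> [//|k IH] kN /=; apply: (InvS (Ordinal kN)); last by apply: IH; exact: ltnW.
by apply: iteri_agree_outside => s'; exact: exec_agree_outside.
Qed.

(* The loop bounds are all evaluated in [s]: this is sound when the registers
   that occur in them are not written. *)
Fixpoint static_time s c : nat :=
  match c with
  | CSkip => 1
  | CSeq c1 c2 => (static_time s c1 + static_time s c2).+1
  | CISet _ e => (icost e).+1
  | CRSet _ e1 e2 e => (icost e1 + icost e2 + rcost e).+1
  | CIfLe e1 e2 c1 c2 =>
      (rcost e1 + rcost e2 + (static_time s c1 + static_time s c2)).+1
  | CFor _ e c1 => (icost e + ieval s e * (static_time s c1).+1).+1
  | CEig _ e _ _ => (icost e + ieval s e ^ 3).+1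
  end%N.

Fixpoint read_regs (e : iexp) : seq nat :=
  match e with
  | IConst _ => [::]
  | IVar x => [:: x]
  | IAdd e1 e2 => read_regs e1 ++ read_regs e2
  end.

Fixpoint bound_regs c : seq nat :=
  match c with
  | CSkip | CISet _ _ | CRSet _ _ _ _ => [::]
  | CSeq c1 c2 | CIfLe _ _ c1 c2 => bound_regs c1 ++ bound_regs c2
  | CFor _ e c1 => read_regs e ++ bound_regs c1
  | CEig _ e _ _ => read_regs e
  end.

Lemma eq_ieval (P : pred nat) s s' e :
  (forall x, P x -> ireg s' x = ireg s x) -> all P (read_regs e) ->
  ieval s' e = ieval s e.
Proof.
move=> ss'; elim: e => [//|x|e1 IH1 e2 IH2] /=; first by rewrite andbT => /ss'.
by rewrite all_cat => /andP[/IH1 -> /IH2 ->].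
Qed.

Lemma time_le_static (P : pred nat) c s s' :
  (forall x, P x -> ireg s' x = ireg s x) ->
  all P (bound_regs c) -> all (predC P) (written_regs c) ->
  (time eig c s' <= static_time s c)%N.
Proof.
have frame c1 s1 : all (predC P) (written_regs c1) ->
    (forall x, P x -> ireg s1 x = ireg s x) ->
    forall x, P x -> ireg (exec eig c1 s1) x = ireg s x.
  move=> /allP not_written s1s x Px; rewrite exec_ireg ?s1s//.
  by apply/negP => /not_written /=; rewrite Px.
elim: c s' => [|c1 IH1 c2 IH2|x e|a e1 e2 e|e1 e2 c1 IH1 c2 IH2|x e c IH|a e b b']
  s' s's //=.
- rewrite !all_cat => /andP[bounds1 bounds2] /andP[writes1 writes2].
  by rewrite ltnS leq_add ?IH1 ?IH2//; exact: frame.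
- rewrite !all_cat => /andP[bounds1 bounds2] /andP[writes1 writes2].
  rewrite ltnS leq_add2l.
  by case: ifP => _;
    [apply: leq_trans (leq_addr _ _) | apply: leq_trans (leq_addl _ _)]; auto.
- rewrite all_cat => /andP[e_bounds c_bounds] /andP[Px c_writes].
  rewrite (eq_ieval s's e_bounds) ltnS leq_add2l -[X in (_ <= X * _)%N]card_ord.
  rewrite -sum_nat_const; apply: leq_sum => k _; rewrite ltnS.
  apply: IH => // y Py; rewrite -s's//=.
  have /negPf y_neq_x : y != x by apply: contra Px => /eqP <-.
  rewrite y_neq_x (iteri_agree_outside _ _ _ (exec_agree_outside _)).1//.
  by rewrite inE y_neq_x /=; apply/negP => /(allP c_writes) /=; rewrite Py.
- by move=> e_bounds _; rewrite (eq_ieval s's e_bounds).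
Qed.

Definition cell00 (a : nat) : rexp R := RGet a (IConst 0) (IConst 0).

Definition set_cell00 (a : nat) (e : rexp R) : cmd R :=
  CRSet a (IConst 0) (IConst 0) e.

Definition for_sum (a x : nat) (e : iexp) (pre : cmd R) (body : rexp R) : cmd R :=
  CSeq (set_cell00 a (RConst 0))
    (CFor x e (CSeq pre (set_cell00 a (RAdd (cell00 a) body)))).

Lemma exec_for_sum N a x e pre body s (g : 'I_N -> R) :
  ieval s e = N -> a \notin written_arrays pre ->
  (forall (k : 'I_N) s',
     agree_outside (x :: written_regs pre) (a :: written_arrays pre) s' s ->
     reval (exec eig pre (set_ireg x k s')) body = g k) ->
  rmem (exec eig (for_sum a x e pre body) s) a 0 0 = \sum_k g k.
Proof.
move=> eN a_pre bodyE; rewrite /for_sum exec_seq.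
set s0 := exec eig (set_cell00 _ _) s.
have s0_agree : agree_outside [::] [:: a] s0 s.
  by apply: agree_outside_set_array; rewrite inE.
pose Inv (k : nat) s' := rmem s' a 0%N 0%N = \sum_(i < N | (i < k)%N) g i.
have -> : \sum_k g k = \sum_(i < N | (i < N)%N) g i.
  by apply: eq_bigl => i; rewrite ltn_ord.
apply: (exec_for_ind (Inv := Inv)).
- by rewrite -eN; apply: (@eq_ieval xpredT) => //; apply/allP.
- by rewrite /Inv /= !eqxx big1.
move=> k s' /=; rewrite cats0 => s'_agree; rewrite /Inv /= !eqxx /=.
rewrite (exec_rmem _ a_pre) /= bodyE => [->|].
  rewrite [RHS](bigD1 k)//= addrC; congr (_ + _); apply: eq_bigl => i.
  by rewrite ltnS ltn_neqAle andbC.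
apply: (@agree_outside_trans _ _ _ s0).
  by apply: agree_outside_sub s'_agree => // y; rewrite mem_cat !inE orbC.
by apply: agree_outside_sub s0_agree => // y; rewrite !inE => ->.
Qed.

Definition for_fill (a : nat) (i : iexp) (x : nat) (e : iexp) (pre : cmd R)
    (body : rexp R) : cmd R :=
  CFor x e (CSeq pre (CRSet a i (IVar x) body)).

Section ForFill.
Variables (N a : nat) (i : iexp) (x : nat) (e : iexp).
Variables (pre : cmd R) (body : rexp R) (s : state R) (g : 'I_N -> R).
Hypotheses (eN : ieval s e = N) (a_pre : a \notin written_arrays pre).
Hypothesis x_pre : x \notin written_regs pre.
Hypothesis i_pre : all (fun y => y \notin x :: written_regs pre) (read_regs i).

Let agree_pre := agree_outside (x :: written_regs pre) (a :: written_arrays pre).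

Let rmem_step k s' r l : agree_pre s' s ->
  rmem (exec eig (CSeq pre (CRSet a i (IVar x) body)) (set_ireg x k s')) a r l =
  if (r == ieval s i) && (l == k) then
    reval (exec eig pre (set_ireg x k s')) body else rmem s' a r l.
Proof.
move=> [regs _] /=; rewrite eqxx (exec_rmem _ a_pre) (exec_ireg _ x_pre) /= eqxx.
suff -> : ieval (exec eig pre (set_ireg x k s')) i = ieval s i by [].
apply: eq_ieval i_pre => y y_out; have := y_out; rewrite inE negb_or.
move=> /andP[yx y_pre].
by rewrite exec_ireg//= (negPf yx) regs.
Qed.

Let loop_agree s' :
  agree_outside (x :: written_regs pre ++ [::]) (written_arrays pre ++ [:: a]) s' s ->
  agree_pre s' s.
Proof.
by rewrite cats0 => /agree_outside_sub; apply=> // y; rewrite mem_cat !inE orbC.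
Qed.

Lemma exec_for_fill :
  (forall (k : 'I_N) s', agree_pre s' s ->
     reval (exec eig pre (set_ireg x k s')) body = g k) ->
  forall l : 'I_N,
    rmem (exec eig (for_fill a i x e pre body) s) a (ieval s i) l = g l.
Proof.
move=> bodyE l; pose Inv k s' := (l < k)%N -> rmem s' a (ieval s i) l = g l.
suff: Inv N (exec eig (for_fill a i x e pre body) s) by apply.
apply: (exec_for_ind (Inv := Inv) eN) => // k s' /loop_agree s'_agree IH.
rewrite /Inv rmem_step// eqxx bodyE// ltnS leq_eqVlt.
by case: eqVneq => [/val_inj ->|_ /IH].
Qed.

Lemma exec_for_fill_other_row r : r != ieval s i ->
  rmem (exec eig (for_fill a i x e pre body) s) a r = rmem s a r.
Proof.
move=> /negPf r_out; apply: (exec_for_ind erefl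
  (Inv := fun _ s' => rmem s' a r = rmem s a r)) => // k s' /loop_agree s'_agree IH.
by apply: funext => l; rewrite rmem_step// r_out IH.
Qed.

End ForFill.

Definition array_mx (m k : nat) (a : nat) s : 'M[R]_(m, k) :=
  \matrix_(i, j) rmem s a i j.

Arguments array_mx {m k}.

Lemma array_mx_exec_eig m (a b b' : nat) e s : ieval s e = m -> b != b' ->
  array_mx b (exec eig (CEig a e b b') s) = (@eig m (array_mx a s)).1 /\
  array_mx b' (exec eig (CEig a e b b') s) = (@eig m (array_mx a s)).2.
Proof.
move=> em bb'; split; apply/matrixP => i j.
  by rewrite mxE /= /exec_eig em /= (negPf bb') eqxx /put_mx !valK.
by rewrite mxE /= /exec_eig em /= eqxx /put_mx !valK.
Qed.

End ProgramLogic.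

Arguments cell00 {R}.
Arguments array_mx {R m k}.

(** * The algorithm *)

Lemma monomial_le_cost (n d a b : nat) : (0 < n)%N -> (0 < d)%N ->
  (a <= 2)%N && (b <= 2)%N || (a <= 1)%N && (b <= 3)%N ->
  (n ^ a * d ^ b <= n ^ 2 * d ^ 2 + n * d ^ 3)%N.
Proof.
move=> n_gt0 d_gt0 /orP[]/andP[a_le b_le].
  by apply: leq_trans (leq_addr _ _); rewrite leq_mul ?leq_pexp2l.
by apply: leq_trans (leq_addl _ _); rewrite -{2}[n]expn1 leq_mul ?leq_pexp2l.
Qed.

Section Programs.
Variables (R : realType) (p : R) (m : nat).

Local Notation "c1 ;; c2" := (CSeq c1 c2) (at level 60, right associativity).

(* Integer registers: the first three are fixed by the input and output
   conventions. *)
Local Notation nrows := 0%N (only parsing).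
Local Notation ncols := 1%N (only parsing).
Local Notation len := 2%N (only parsing).
Local Notation cur := 3%N (only parsing).
Local Notation row_ix := 4%N (only parsing).
Local Notation col_ix := 5%N (only parsing).
Local Notation col_ix' := 6%N (only parsing).
Local Notation best := 7%N (only parsing).

(* Arrays: the first four are fixed by the input and output conventions. *)
Local Notation input := 0%N (only parsing).
Local Notation vectors := 1%N (only parsing).
Local Notation value := 2%N (only parsing).
Local Notation witness := 3%N (only parsing).
Local Notation vec_sq := 4%N (only parsing).
Local Notation dot := 5%N (only parsing).
Local Notation weights := 6%N (only parsing).
Local Notation entry := 7%N (only parsing).
Local Notation gram := 8%N (only parsing).
Local Notation eigvecs := 9%N (only parsing).
Local Notation eigvals := 10%N (only parsing).
Local Notation psum := 11%N (only parsing).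
Local Notation qsum := 12%N (only parsing).
Local Notation ratio := 13%N (only parsing).
Local Notation best_norm := 14%N (only parsing).

Definition even_power (e : rexp R) (k : nat) : rexp R := RPow (RMul e e) k%:R.

(* The machine has no absolute value: |x| ^ r is computed as (x ^ 2) ^ (r / 2). *)
Definition abs_power (e : rexp R) (r : R) : rexp R := RPow (RMul e e) (r / 2).

Definition dot_prog : cmd R :=
  for_sum dot col_ix (IVar ncols) CSkip
    (RMul (RGet input (IVar row_ix) (IVar col_ix))
       (RGet vectors (IVar cur) (IVar col_ix))).

Definition copy_row_prog : cmd R :=
  for_fill vectors (IVar cur) col_ix (IVar ncols) CSkip
    (RGet input (IVar cur) (IVar col_ix)).

Definition sqnorm_prog : cmd R :=
  for_sum vec_sq col_ix (IVar ncols) CSkip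
    (RMul (RGet vectors (IVar cur) (IVar col_ix))
       (RGet vectors (IVar cur) (IVar col_ix))).

(* A zero row is replaced by a unit vector, as the list may not contain 0. *)
Definition nonzero_prog : cmd R :=
  sqnorm_prog ;;
  CIfLe (cell00 vec_sq) (RConst 0) (CRSet vectors (IVar cur) (IConst 0) (RConst 1)) CSkip.

Definition weights_prog : cmd R :=
  for_fill weights (IConst 0) row_ix (IVar nrows) dot_prog
    (even_power (cell00 dot) m).

Definition gram_prog : cmd R :=
  CFor col_ix (IVar ncols)
    (for_fill gram (IVar col_ix) col_ix' (IVar ncols)
       (for_sum entry row_ix (IVar nrows) CSkip
          (RMul (RGet weights (IConst 0) (IVar row_ix))
             (RMul (RGet input (IVar row_ix) (IVar col_ix))
                (RGet input (IVar row_ix) (IVar col_ix')))))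
       (cell00 entry)).

Definition argmax_prog : cmd R :=
  CISet best (IConst 0) ;;
  CFor col_ix (IVar ncols)
    (CIfLe (RGet eigvals (IConst 0) (IVar best))
       (RGet eigvals (IConst 0) (IVar col_ix))
       (CISet best (IVar col_ix)) CSkip).

Definition copy_eigvec_prog : cmd R :=
  for_fill vectors (IAdd (IVar nrows) (IVar cur)) col_ix (IVar ncols) CSkip
    (RGet eigvecs (IVar col_ix) (IVar best)).

Definition row_prog : cmd R := copy_row_prog ;; nonzero_prog.

Definition eigvec_prog : cmd R :=
  weights_prog ;; gram_prog ;; CEig gram (IVar ncols) eigvecs eigvals ;;
  argmax_prog ;; copy_eigvec_prog.

Definition pair_prog : cmd R := row_prog ;; eigvec_prog.

Definition list_prog : cmd R :=
  CISet len (IAdd (IVar nrows) (IVar nrows)) ;; CFor cur (IVar nrows) pair_prog.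

Definition psum_prog : cmd R :=
  for_sum psum col_ix (IVar ncols) CSkip
    (abs_power (RGet vectors (IVar cur) (IVar col_ix)) p).

Definition qsum_prog : cmd R :=
  for_sum qsum row_ix (IVar nrows) dot_prog
    (even_power (cell00 dot) m.+1).

Definition pnorm : rexp R := RPow (cell00 psum) p^-1.

Definition ratio_prog : cmd R :=
  psum_prog ;; qsum_prog ;;
  set_cell00 ratio (RDiv (RPow (cell00 qsum) (2 * m.+1)%:R^-1) pnorm).

Definition update_prog : cmd R :=
  CIfLe (cell00 value) (cell00 ratio)
    (set_cell00 value (cell00 ratio) ;; CISet best (IVar cur) ;;
     set_cell00 best_norm pnorm)
    CSkip.

Definition scan_prog : cmd R :=
  set_cell00 value (RConst 0) ;; CFor cur (IVar len) (ratio_prog ;; update_prog).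

Definition normalize_prog : cmd R :=
  for_fill witness (IConst 0) col_ix (IVar ncols) CSkip
    (RDiv (RGet vectors (IVar best) (IVar col_ix)) (cell00 best_norm)).

Definition scale_prog : cmd R :=
  set_cell00 value
    (RMul (RPow (RNat (IVar ncols)) (gamma_exp p + 4^-1 - (2 * (2 * m.+1)%:R)^-1))
       (cell00 value)).

Definition report_prog : cmd R := scan_prog ;; normalize_prog ;; scale_prog.

Variables (eig : eig_fun R) (n d : nat) (X : 'M[R]_(n, d)).
Implicit Types s : state R.

Definition input_loaded s :=
  [/\ ireg s nrows = n, ireg s ncols = d & array_mx input s = X].

Definition stored_vec s k : 'cV[R]_d := \col_j rmem s vectors k j.

Lemma input_loaded_init : input_loaded (init_state X).
Proof. by split=> //; apply/matrixP => i j; rewrite mxE /= /put_mx !valK. Qed.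

Lemma rmem_input s (i : 'I_n) (j : 'I_d) : input_loaded s -> rmem s input i j = X i j.
Proof. by move=> [_ _ <-]; rewrite mxE. Qed.

Lemma input_loaded_agree xs bs s s' :
  nrows \notin xs -> ncols \notin xs -> input \notin bs ->
  agree_outside xs bs s' s -> input_loaded s -> input_loaded s'.
Proof.
move=> nrows_out ncols_out input_out [regs mem] [sn sd sX].
by split; rewrite ?regs// /array_mx mem.
Qed.

Lemma input_loaded_exec c s :
  nrows \notin written_regs c -> ncols \notin written_regs c ->
  input \notin written_arrays c -> input_loaded s -> input_loaded (exec eig c s).
Proof.
by move=> *; apply: input_loaded_agree (exec_agree_outside eig c s) _.
Qed.

Lemma stored_vec_exec c s k : vectors \notin written_arrays c ->
  stored_vec (exec eig c s) k = stored_vec s k.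
Proof. by move=> c_out; rewrite /stored_vec exec_rmem. Qed.

Lemma array_mx_exec (k l a : nat) c s : a \notin written_arrays c ->
  array_mx a (exec eig c s) = array_mx a s :> 'M[R]_(k, l).
Proof. by move=> c_out; rewrite /array_mx exec_rmem. Qed.

Lemma reval_even_power s e k : reval s (even_power e k) = reval s e ^+ 2 ^+ k.
Proof. by rewrite /= -expr2 powR_mulrn ?sqr_ge0. Qed.

Lemma reval_abs_power s e r : reval s (abs_power e r) = `|reval s e| `^ r.
Proof. by rewrite /= -expr2 sqr_powR. Qed.

Lemma exec_dot s (i : 'I_n) : input_loaded s ->
  rmem (exec eig dot_prog (set_ireg row_ix i s)) dot 0 0 =
  (X *m stored_vec s (ireg s cur)) i 0.
Proof.
move=> sI; have [_ sd _] := sI.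
rewrite mxE; apply: exec_for_sum => // j s' [regs mem] /=.
by rewrite !mem// regs//= regs//= mxE rmem_input.
Qed.

Lemma exec_copy_row s (k : 'I_n) : input_loaded s -> ireg s cur = k ->
  stored_vec (exec eig copy_row_prog s) k = (row k X)^T.
Proof.
move=> sI sk; have [_ sd _] := sI; apply/colP => j; rewrite !mxE -sk.
rewrite (exec_for_fill (g := fun j => X k j))// => l s' [regs mem] /=.
by rewrite mem// regs// sk rmem_input.
Qed.

Lemma exec_copy_row_other s r : r != ireg s cur ->
  stored_vec (exec eig copy_row_prog s) r = stored_vec s r.
Proof. by move=> r_cur; rewrite /stored_vec (exec_for_fill_other_row _ _). Qed.

Lemma exec_sqnorm s : ireg s ncols = d ->
  rmem (exec eig sqnorm_prog s) vec_sq 0 0 = sqnorm (stored_vec s (ireg s cur)).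
Proof.
move=> sd; apply: exec_for_sum => // j s' [regs mem] /=.
by rewrite mem// regs// !mxE.
Qed.

Lemma exec_nonzero s : ireg s ncols = d ->
  stored_vec (exec eig nonzero_prog s) (ireg s cur) =
  if stored_vec s (ireg s cur) == 0 then \col_(j < d) (j == 0 :> nat)%:R
  else stored_vec s (ireg s cur).
Proof.
move=> sd; rewrite /nonzero_prog exec_seq; set s' := exec eig sqnorm_prog s.
have s'_cur : ireg s' cur = ireg s cur by rewrite exec_ireg.
have s'_vec : rmem s' vectors = rmem s vectors by rewrite exec_rmem.
apply/colP => j; rewrite /= exec_sqnorm// le_eqVlt ltNge sqnorm_ge0 orbF sqnorm_eq0.
case: eqVneq => [/colP/(_ j)|_]; last by rewrite !mxE s'_vec.
by rewrite !mxE /= s'_cur s'_vec eqxx => ->; case: eqP.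
Qed.

Lemma exec_nonzero_other s r : r != ireg s cur ->
  stored_vec (exec eig nonzero_prog s) r = stored_vec s r.
Proof.
move=> /negPf r_cur; rewrite /nonzero_prog exec_seq.
rewrite -(stored_vec_exec (c := sqnorm_prog) s)//; set s' := exec eig sqnorm_prog s.
have s'_cur : ireg s' cur = ireg s cur by rewrite exec_ireg.
by apply/colP => j; rewrite /=; case: ifP; rewrite !mxE //= s'_cur r_cur.
Qed.

Lemma exec_weights s : input_loaded s ->
  array_mx weights (exec eig weights_prog s) =
  \row_i (X *m stored_vec s (ireg s cur)) i 0 ^+ 2 ^+ m.
Proof.
move=> sI; have [sn _ _] := sI; apply/matrixP => r i.
rewrite ord1 mxE [RHS]mxE; apply: (exec_for_fill (i := IConst 0) (N := n)
  (g := fun i => (X *m stored_vec s (ireg s cur)) i 0 ^+ 2 ^+ m)) => // l s' agree_s'.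
have s'I : input_loaded s' by apply: input_loaded_agree agree_s' sI.
have [regs mem] := agree_s'.
by rewrite reval_even_power [reval _ _]exec_dot// /stored_vec mem// regs.
Qed.

Lemma exec_gram s : input_loaded s ->
  array_mx gram (exec eig gram_prog s) =
  X^T *m diag_mx (array_mx weights s) *m X.
Proof.
move=> sI; have [sn sd _] := sI; set G := _ *m X.
have GE j l : G j l = \sum_(i < n) rmem s weights 0 i * (X i j * X i l).
  by rewrite mxE; apply: eq_bigr => i _; rewrite mul_mx_diag !mxE mulrCA mulrA.
pose filled (k : nat) s' := forall j l : 'I_d, (j < k)%N -> rmem s' gram j l = G j l.
suff : filled d (exec eig gram_prog s).
  by move=> filled_d; apply/matrixP => j l; rewrite mxE filled_d.
apply: (exec_for_ind (Inv := filled)) => // k s_col [regs_col mem_col] IH j l.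
rewrite ltnS leq_eqVlt; case: eqVneq => [/val_inj -> _ |jk j_lt_k]; last first.
  rewrite exec_for_fill_other_row//; exact: IH.
apply: (exec_for_fill (i := IVar col_ix)) => [|||//|l' s_fill [regs_fill mem_fill]] //.
  by rewrite /= regs_col.
rewrite GE; apply: exec_for_sum => [|//|i s_sum [regs_sum mem_sum]].
  by rewrite /= !regs_fill//= regs_col.
rewrite /= !mem_sum// !regs_sum//= !mem_fill// !regs_fill//= !mem_col//.
by rewrite !rmem_input.
Qed.

Lemma exec_argmax s : (0 < d)%N -> ireg s ncols = d ->
  exists t : 'I_d, ireg (exec eig argmax_prog s) best = t /\
    forall j : 'I_d, rmem s eigvals 0 j <= rmem s eigvals 0 t.
Proof.
move=> d_gt0 sd; pose is_max (k : nat) s' := (ireg s' best < d)%N /\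
  forall j, (j < k)%N -> rmem s eigvals 0 j <= rmem s eigvals 0 (ireg s' best).
suff [t_lt t_max] : is_max d (exec eig argmax_prog s).
  by exists (Ordinal t_lt); split=> // j; exact: t_max.
rewrite /argmax_prog exec_seq.
apply: (exec_for_ind (Inv := is_max)) => // k s' [_ mem] [t_lt t_max].
rewrite /is_max /= mem//; case: leP => [k_ge|/ltW k_le] /=; split=> // j;
  rewrite ltnS leq_eqVlt => /predU1P[-> //|/t_max //].
by move=> /le_trans; apply.
Qed.

Lemma exec_copy_eigvec s (k : 'I_n) (t : 'I_d) : input_loaded s ->
  ireg s cur = k -> ireg s best = t ->
  stored_vec (exec eig copy_eigvec_prog s) (n + k) = col t (array_mx eigvecs s).
Proof.
move=> sI sk st; have [sn sd _] := sI; apply/colP => j; rewrite !mxE -{1}sn -sk.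
apply: (exec_for_fill (i := IAdd (IVar nrows) (IVar cur))
  (g := fun j : 'I_d => rmem s eigvecs j t)) => // l s' [regs mem].
by rewrite /= mem// regs// st.
Qed.

Lemma exec_copy_eigvec_other s r : r != (ireg s nrows + ireg s cur)%N ->
  stored_vec (exec eig copy_eigvec_prog s) r = stored_vec s r.
Proof. by move=> r_out; rewrite /stored_vec (exec_for_fill_other_row _ _). Qed.

Lemma exec_row s (k : 'I_n) : (0 < d)%N -> input_loaded s -> ireg s cur = k ->
  let u := stored_vec (exec eig row_prog s) k in
  u != 0 /\ (row k X != 0 -> u = (row k X)^T).
Proof.
move=> d_gt0 sI sk; rewrite /row_prog exec_seq; set s' := exec eig copy_row_prog s.
have [_ s'd _] : input_loaded s' by exact: input_loaded_exec.
have s'k : ireg s' cur = k by rewrite exec_ireg.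
have := exec_nonzero s'd; rewrite s'k exec_copy_row// => ->.
case: (eqVneq (row k X)^T 0) => [row0|] //.
split=> [|/eqP[]]; last by apply: trmx_inj; rewrite row0 trmx0.
apply/eqP => /colP/(_ (Ordinal d_gt0)); rewrite !mxE /= => /eqP.
by rewrite oner_eq0.
Qed.

Lemma exec_row_other s r : r != ireg s cur ->
  stored_vec (exec eig row_prog s) r = stored_vec s r.
Proof.
move=> r_cur; rewrite /row_prog exec_seq exec_nonzero_other ?exec_copy_row_other//.
by rewrite exec_ireg.
Qed.

Lemma exec_eigvec s (k : 'I_n) :
  eigensolver eig -> (0 < d)%N -> input_loaded s -> ireg s cur = k ->
  stored_vec s k != 0 -> (row k X != 0 -> stored_vec s k = (row k X)^T) ->
  row_eigen_pair X m k (stored_vec s k)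
    (stored_vec (exec eig eigvec_prog s) (n + k)).
Proof.
move=> eigP d_gt0 sI sk u_neq0 uE; rewrite /eigvec_prog !exec_seq.
set s_wt := exec eig weights_prog s; set s_gram := exec eig gram_prog s_wt.
set s_eig := exec eig _ s_gram; set s_max := exec eig argmax_prog s_eig.
have s_wtI : input_loaded s_wt by exact: input_loaded_exec.
have s_gramI : input_loaded s_gram by exact: input_loaded_exec.
have s_eigI : input_loaded s_eig by exact: input_loaded_exec.
have s_maxI : input_loaded s_max by exact: input_loaded_exec.
have [_ s_gram_d _] := s_gramI; have [_ s_eig_d _] := s_eigI.
have [t [s_max_t t_max]] := exec_argmax d_gt0 s_eig_d.
have s_max_k : ireg s_max cur = k by rewrite !exec_ireg.
rewrite (exec_copy_eigvec s_maxI s_max_k s_max_t) array_mx_exec//.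
have [-> eigvalsE] := array_mx_exec_eig eig gram (e := IVar ncols)
  s_gram_d (isT : eigvecs != eigvals).
have gramE : array_mx gram s_gram =
    X^T *m diag_mx (\row_i (X *m stored_vec s k) i 0 ^+ 2 ^+ m) *m X.
  by rewrite exec_gram// exec_weights// sk.
have [|UU GU] := eigP d (array_mx gram s_gram).
  by rewrite gramE !trmx_mul trmxK tr_diag_mx mulmxA.
apply: (row_eigen_pair_gram u_neq0 uE UU); first by rewrite -gramE; exact: GU.
by move=> j; rewrite -eigvalsE !mxE.
Qed.

Lemma exec_eigvec_other s r : input_loaded s -> r != (n + ireg s cur)%N ->
  stored_vec (exec eig eigvec_prog s) r = stored_vec s r.
Proof.
move=> sI r_out; have [sn _ _] := sI.
rewrite /eigvec_prog !exec_seq exec_copy_eigvec_other ?stored_vec_exec//.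
by rewrite !exec_ireg// sn.
Qed.

Lemma exec_pair s (k : 'I_n) :
  eigensolver eig -> (0 < d)%N -> input_loaded s -> ireg s cur = k ->
  let s' := exec eig pair_prog s in
  row_eigen_pair X m k (stored_vec s' k) (stored_vec s' (n + k)).
Proof.
move=> eigP d_gt0 sI sk; rewrite /pair_prog exec_seq.
have [] := exec_row d_gt0 sI sk; set s' := exec eig row_prog s => u_neq0 uE.
have s'I : input_loaded s' by exact: input_loaded_exec.
have s'k : ireg s' cur = k by rewrite exec_ireg.
cbv zeta; rewrite [stored_vec _ k]exec_eigvec_other//; first exact: exec_eigvec.
by rewrite s'k ltn_eqF// ltn_addr.
Qed.

Lemma exec_pair_other s r : input_loaded s ->
  r != ireg s cur -> r != (n + ireg s cur)%N ->
  stored_vec (exec eig pair_prog s) r = stored_vec s r.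
Proof.
move=> sI r_cur r_eig; rewrite /pair_prog exec_seq.
rewrite exec_eigvec_other ?exec_row_other ?exec_ireg//.
exact: input_loaded_exec.
Qed.

Lemma exec_list_pairs s : eigensolver eig -> (0 < d)%N -> input_loaded s ->
  let s' := exec eig list_prog s in
  forall k : 'I_n, row_eigen_pair X m k (stored_vec s' k) (stored_vec s' (n + k)).
Proof.
move=> eigP d_gt0 sI; rewrite /list_prog exec_seq; set s0 := exec eig (CISet _ _) s.
have s0I : input_loaded s0 by exact: input_loaded_exec.
have [s0n _ _] := s0I.
pose paired (k : nat) s' := forall i : 'I_n, (i < k)%N ->
  row_eigen_pair X m i (stored_vec s' i) (stored_vec s' (n + i)).
suff paired_n : paired n (exec eig (CFor cur (IVar nrows) pair_prog) s0).
  by move=> k; exact: paired_n.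
apply: (exec_for_ind (Inv := paired)) => // k s' s'_agree IH i.
have s'I : input_loaded (set_ireg cur k s') by exact: input_loaded_agree s'_agree s0I.
rewrite ltnS leq_eqVlt; case: eqVneq => [/val_inj -> _|ik /= i_lt_k].
  exact: exec_pair.
rewrite !exec_pair_other//; first exact: IH.
- by rewrite /= gtn_eqF// ltn_addr.
- by rewrite /= eqn_add2l.
- by rewrite /= ltn_eqF// ltn_addr.
Qed.

Lemma exec_list_len s :
  ireg s nrows = n -> ireg (exec eig list_prog s) len = (n + n)%N.
Proof. by move=> sn; rewrite /list_prog exec_seq exec_ireg//= sn. Qed.

Lemma out_list_codom s : ireg s len = (n + n)%N ->
  out_list d s = codom (fun k : 'I_n => stored_vec s k) ++
                 codom (fun k : 'I_n => stored_vec s (n + k)).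
Proof.
move=> s_len; rewrite /out_list s_len iotaD map_cat add0n; congr (_ ++ _).
  by rewrite -val_enum_ord -map_comp.
by rewrite -[n in iota n]addn0 iotaDl -val_enum_ord -2!map_comp.
Qed.

Local Notation q := (2 * m.+1)%N.

Lemma exec_psum s : ireg s ncols = d ->
  reval (exec eig psum_prog s) pnorm = lpnorm p (stored_vec s (ireg s cur)).
Proof.
move=> sd; rewrite /pnorm [LHS]/(_ `^ _); congr (_ `^ _).
apply: exec_for_sum => // j s' [regs mem].
by rewrite reval_abs_power /= mem// regs// mxE.
Qed.

Lemma exec_qsum s : input_loaded s ->
  rmem (exec eig qsum_prog s) qsum 0 0 =
  power_sum X m.+1 (stored_vec s (ireg s cur)).
Proof.
move=> sI; have [sn _ _] := sI; apply: exec_for_sum => // i s' s'_agree.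
have s'I : input_loaded s' by exact: input_loaded_agree s'_agree sI.
have [regs mem] := s'_agree.
by rewrite reval_even_power [reval _ _]exec_dot// /stored_vec mem// regs.
Qed.

Lemma exec_ratio s : input_loaded s ->
  let v := stored_vec s (ireg s cur) in let s' := exec eig ratio_prog s in
  rmem s' ratio 0 0 = norm_ratio X p q v /\ reval s' pnorm = lpnorm p v.
Proof.
move=> sI; have [_ sd _] := sI; rewrite /ratio_prog !exec_seq.
set s_p := exec eig psum_prog s; set s_q := exec eig qsum_prog s_p.
have s_pI : input_loaded s_p by exact: input_loaded_exec.
have s_q_pnorm : reval s_q pnorm = lpnorm p (stored_vec s (ireg s cur)).
  by rewrite -exec_psum// /pnorm /= exec_rmem.
split; last by rewrite -s_q_pnorm.
rewrite -[LHS]/(rmem s_q qsum 0 0 `^ q%:R^-1 / reval s_q pnorm) s_q_pnorm.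
rewrite exec_qsum// exec_ireg// stored_vec_exec//.
by rewrite /norm_ratio lpnorm_even.
Qed.

Definition scanned s (k : nat) s' :=
  rmem s' value 0 0 =
    \big[Num.max/0]_(i < ireg s len | (i < k)%N) norm_ratio X p q (stored_vec s i) /\
  ((0 < k)%N -> let v := stored_vec s (ireg s' best) in
   [/\ (ireg s' best < k)%N, norm_ratio X p q v = rmem s' value 0 0 &
       rmem s' best_norm 0 0 = lpnorm p v]).

Lemma scanned_step s (k : 'I_(ireg s len)) s' : input_loaded s' ->
  (forall i, stored_vec s' i = stored_vec s i) -> scanned s k s' ->
  scanned s k.+1 (exec eig (ratio_prog ;; update_prog) (set_ireg cur k s')).
Proof.
move=> s'I s'_vec [max_k arg_k]; rewrite exec_seq.
set s_cur := set_ireg cur k s'; set s_r := exec eig ratio_prog s_cur.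
have [] := @exec_ratio s_cur s'I; rewrite -/s_r [stored_vec _ _]s'_vec.
set r := norm_ratio _ _ _ _ => s_r_ratio s_r_pnorm.
have s_r_value : rmem s_r value 0 0 = rmem s' value 0 0 by rewrite exec_rmem.
have s_r_norm : rmem s_r best_norm 0 0 = rmem s' best_norm 0 0 by rewrite exec_rmem.
have s_r_best : ireg s_r best = ireg s' best by rewrite exec_ireg.
have s_r_cur : ireg s_r cur = k by rewrite exec_ireg.
have max_kS : \big[Num.max/0]_(i < ireg s len | (i < k.+1)%N)
    norm_ratio X p q (stored_vec s i) = Num.max r (rmem s' value 0 0).
  rewrite (bigmaxD1 k)//= max_k; congr Num.max; apply: eq_bigl => i.
  by rewrite ltnS ltn_neqAle andbC.
clearbody s_r; rewrite /= in s_r_pnorm.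
rewrite /scanned max_kS /= s_r_ratio s_r_value.
case: leP => [r_ge|r_lt] /=; first by rewrite s_r_cur s_r_pnorm.
have [k_eq0|k_gt0] := posnP k.
  move: r_lt; rewrite max_k big_pred0 => [|i]; last by rewrite k_eq0.
  by rewrite ltNge norm_ratio_ge0.
have [best_lt best_max best_norm_v] := arg_k k_gt0.
by rewrite s_r_value s_r_norm s_r_best; split=> // _; split=> //; exact: ltnW.
Qed.

Lemma exec_scan s : input_loaded s -> scanned s (ireg s len) (exec eig scan_prog s).
Proof.
move=> sI; rewrite /scan_prog exec_seq; set s0 := exec eig (set_cell00 _ _) s.
have s0I : input_loaded s0 by exact: input_loaded_exec.
apply: (exec_for_ind (Inv := scanned s)) => // [|k s' s'_agree IH].
  by split=> //; rewrite big_pred0 //= !eqxx.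
apply: scanned_step => // [|i]; first exact: input_loaded_agree s'_agree s0I.
by rewrite /stored_vec s'_agree.2.
Qed.

Lemma max_ratio_out_list s : max_ratio p q X (out_list d s) =
  \big[Num.max/0]_(i < ireg s len | (i < ireg s len)%N)
    norm_ratio X p q (stored_vec s i).
Proof.
rewrite /max_ratio big_map -[X in iota 0 X]subn0 -/(index_iota _ _) big_mkord.
by apply: eq_bigl => i; rewrite ltn_ord.
Qed.

Lemma exec_report s : input_loaded s -> (0 < ireg s len)%N ->
  let L := out_list d s in let s' := exec eig report_prog s in
  out_num s' = approx_factor p q d * max_ratio p q X L /\
  exists2 v, v \in L & norm_ratio X p q v = max_ratio p q X L /\
    out_vec d s' = (lpnorm p v)^-1 *: v.
Proof.
move=> sI len_gt0 L; rewrite /report_prog !exec_seq.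
set s_scan := exec eig scan_prog s; set s_norm := exec eig normalize_prog s_scan.
have [value_max /(_ len_gt0) [best_lt best_max best_norm_v]] := exec_scan sI.
rewrite -max_ratio_out_list -/L in value_max.
rewrite -/s_scan in best_lt best_max best_norm_v *.
have [_ s_scan_d _] : input_loaded s_scan by exact: input_loaded_exec.
have s_norm_d : ireg s_norm ncols = d by rewrite exec_ireg.
have s_norm_value : rmem s_norm value 0 0 = rmem s_scan value 0 0.
  by rewrite exec_rmem.
split; first by rewrite /out_num /= s_norm_d s_norm_value value_max.
exists (stored_vec s (ireg s_scan best)); first by apply: map_f; rewrite mem_iota.
split; first by rewrite best_max value_max.
apply/colP => j; rewrite !mxE exec_rmem//.
set v := stored_vec s _ in best_norm_v *.
apply: (exec_for_fill (i := IConst 0) (N := d) (g := fun j =>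
  (lpnorm p v)^-1 * rmem s vectors (ireg s_scan best) j)) => // l s' [regs mem].
by rewrite /= !mem// regs// best_norm_v mulrC exec_rmem.
Qed.

Lemma exec_list_approximating s :
  eigensolver eig -> 1 <= p -> (0 < n)%N -> (0 < d)%N -> input_loaded s ->
  approximating X p q (approx_factor p q d) (out_list d (exec eig list_prog s)).
Proof.
move=> eigP p_ge1 n_gt0 d_gt0 sI; have [sn _ _] := sI.
rewrite out_list_codom ?exec_list_len//.
by apply: row_eigen_pairs_approximating => // k; exact: exec_list_pairs.
Qed.

Lemma exec_list_report s : input_loaded s -> (0 < n)%N ->
  let L := out_list d (exec eig list_prog s) in
  let s' := exec eig (list_prog ;; report_prog) s in
  out_num s' = approx_factor p q d * max_ratio p q X L /\
  exists2 v, v \in L & norm_ratio X p q v = max_ratio p q X L /\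
    out_vec d s' = (lpnorm p v)^-1 *: v.
Proof.
move=> sI n_gt0; have [sn _ _] := sI; apply: exec_report.
  exact: input_loaded_exec.
by rewrite exec_list_len// addn_gt0 n_gt0.
Qed.

Lemma time_list s : input_loaded s -> (0 < n)%N -> (0 < d)%N ->
  (time eig list_prog s <= 300 * (n ^ 2 * d ^ 2 + n * d ^ 3))%N.
Proof.
move=> [sn sd _] n_gt0 d_gt0.
apply: leq_trans (@time_le_static _ _ (fun x => x < 2)%N _ s _ _ _ _) _ => //.
cbn -[addn muln expn leq]; rewrite !sn !sd.
have le_cost a b := @monomial_le_cost n d a b n_gt0 d_gt0.
move: (le_cost 0 0 isT) (le_cost 1 0 isT) (le_cost 2 0 isT) (le_cost 1 1 isT)
  (le_cost 2 1 isT) (le_cost 1 2 isT).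
lia.
Qed.

Lemma time_report s : input_loaded s -> (0 < n)%N -> (0 < d)%N ->
  ireg s len = (n + n)%N ->
  (time eig report_prog s <= 300 * (n ^ 2 * d ^ 2 + n * d ^ 3))%N.
Proof.
move=> [sn sd _] n_gt0 d_gt0 s_len.
apply: leq_trans (@time_le_static _ _ (fun x => x < 3)%N _ s _ _ _ _) _ => //.
cbn -[addn muln expn leq]; rewrite !sn !sd !s_len.
have le_cost a b := @monomial_le_cost n d a b n_gt0 d_gt0.
move: (le_cost 0 0 isT) (le_cost 1 0 isT) (le_cost 0 1 isT) (le_cost 1 1 isT)
  (le_cost 2 0 isT) (le_cost 2 1 isT).
lia.
Qed.

Lemma time_list_report s : input_loaded s -> (0 < n)%N -> (0 < d)%N ->
  (time eig (list_prog ;; report_prog) s <= 601 * (n ^ 2 * d ^ 2 + n * d ^ 3))%N.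
Proof.
move=> sI n_gt0 d_gt0; have [sn _ _] := sI.
have s'I : input_loaded (exec eig list_prog s) by exact: input_loaded_exec.
have cost_gt0 := @monomial_le_cost n d 0 0 n_gt0 d_gt0 isT.
rewrite time_seq; move: (time_report s'I n_gt0 d_gt0 (exec_list_len sn)).
move: (time_list sI n_gt0 d_gt0) cost_gt0; move: (time _ _ _) (time _ _ _) (_ + _)%N.
lia.
Qed.

End Programs.

Lemma even_gt0_double q : ~~ odd q -> (0 < q)%N -> exists m, q = (2 * m.+1)%N.
Proof.
move=> q_even q_gt0; exists q./2.-1.
by rewrite mul2n prednK ?even_halfK// half_gt0; case: q q_gt0 q_even => [|[]].
Qed.

Theorem theorem3p6 (R : realType) :
  exists C : nat,
  forall (p : R) (q : nat), ~~ odd q -> 1 <= p -> p <= q%:R ->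
  exists cList cCert cVec : cmd R,
  forall eig : eig_fun R, eigensolver eig ->
  forall (n d : nat) (X : 'M[R]_(n, d)), (0 < n)%N -> (0 < d)%N ->
  let run c := exec eig c (init_state X) in
  let cost c := time eig c (init_state X) in
  let bound := (C * (n ^ 2 * d ^ 2 + n * d ^ 3))%N in
  let D := approx_factor p q d in
  let N := opnorm p q%:R X in
  [/\ (cost cList <= bound)%N /\
      (let L := out_list d (run cList) in
       [/\ (0 < size L <= C * (n + d))%N,
           {in L, forall v, v <> 0},
           N <= D * max_ratio p q X L
         & D * max_ratio p q X L <= D * N]),
      (cost (CSeq cList cCert) <= bound)%N /\
      (let alg := out_num (run (CSeq cList cCert)) in
       N <= alg /\ forall alpha : R, 0 < alpha -> N <= alpha -> alg <= alpha * D)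
    & (cost (CSeq cList cVec) <= bound)%N /\
      (let v := out_vec d (run (CSeq cList cVec)) in
       lpnorm p v = 1 /\ N / D <= lpnorm q%:R (X *m v))].
Proof.
exists 601%N => p q q_even p_ge1 p_le_q; have p_gt0 := lt_le_trans ltr01 p_ge1.
have [|m ->] := even_gt0_double q_even.
  by rewrite -(ltr0n R); exact: lt_le_trans p_le_q.
exists (list_prog R m), (report_prog p m), (report_prog p m).
move=> eig eigP n d X n_gt0 d_gt0 run cost bound D N; set L := out_list d _.
have initI := input_loaded_init X; have [init_n _ _] := initI.
have L_approx : approximating X p (2 * m.+1) D L by exact: exec_list_approximating.
have D_gt0 : 0 < D by rewrite powR_gt0 ?ltr0n.
have upper := opnorm_le_max_ratio p_gt0 (ltW D_gt0) L_approx.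
have lower := max_ratio_le_opnorm p_gt0 (isT : (0 < 2 * m.+1)%N) (ltW D_gt0) L_approx.
have time_le : (cost (CSeq (list_prog R m) (report_prog p m)) <= bound)%N.
  exact: time_list_report.
have [numE [v /L_approx.1 v_neq0 [v_max vecE]]] :=
  exec_list_report p m eig initI n_gt0.
split; split=> //.
- by apply: leq_trans time_le; rewrite /cost time_seq -addnS leq_addr.
- split; rewrite ?ler_pM2l//; last by move=> z /L_approx.1/eqP.
  by rewrite size_map size_iota (exec_list_len m eig init_n) addn_gt0 n_gt0 /=; lia.
- rewrite /run numE; split=> // alpha _ N_le.
  by rewrite mulrC ler_wpM2r ?(ltW D_gt0) ?(le_trans lower).
- rewrite /run vecE lpnorm_normalize// norm_ratio_normalize// v_max.
  by rewrite ler_pdivrMr// mulrC.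
Qed.
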